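(* Let $A,B\in\operatorname{M}_n(\mathbb{Z})$ be non-singular, let $K\subset\overline{\mathbb{Q}}$ be any finite extension of $\mathbb{Q}$ containing the eigenvalues of both $A$ and $B$, and assume both $G_A$ and $G_B$ admit a characteristic relative to the standard basis of $\mathbb{Z}^n$ (coefficients $\alpha_{pij}(A)$, $\alpha_{pij}(B)$). Let $T\in\operatorname{GL}_n(\mathbb{Q})$. Then $T(G_A)=G_B$ if and only if: $\mathcal P(A)=\mathcal P(B)$; $\mathcal P'(A)=\mathcal P'(B)$ (call it $\mathcal P'$); $\mathcal R(A)=\mathcal R(B)$ (call it $\mathcal R$); $t_p(A)=t_p(B)$ for all $p\in\mathcal P(A)$; $T\in\operatorname{GL}_n(\mathcal R)$; for every $p\in\mathcal P'$ and every prime ideal $\mathfrak p$ of $\mathcal O_K$ above $p$ we have $T(X_{A,\mathfrak p})=X_{B,\mathfrak p}$; and for every $p\in\mathcal P'$, $T$ satisfies condition $(A,B,p)$ and $T^{-1}$ satisfies condition $(B,A,p)$.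
   Context: For a non-singular $A\in\operatorname{M}_n(\mathbb{Z})$: $G_A=\{A^{-k}\mathbf x:\mathbf x\in\mathbb{Z}^n,\ k\in\mathbb{Z}\}\subseteq\mathbb{Q}^n$; $h_A$ its characteristic polynomial; for a prime $p$, $\overline G_{A,p}$ is the $\mathbb{Z}_p$-submodule of $\mathbb{Q}_p^n$ generated by $G_A$; $t_p(A)$ is the multiplicity of $0$ as a root of $h_A \bmod p$; $\mathcal P(A)$ is the set of primes dividing $\det A$; $\mathcal P'(A)=\{p\in\mathcal P(A): h_A\not\equiv x^n\pmod p\}$; $\mathcal R(A)=\mathbb{Z}[1/\det A]$. $\mathcal O_K$ is the ring of integers of $K$. $X_{A,\mathfrak p}\subseteq K^n$ is the $K$-span of all generalized eigenvectors of $A$ belonging to eigenvalues $\lambda$ (algebraic integers in $\mathcal O_K$) with $\lambda\in\mathfrak p$. $G_A$ admits a characteristic relative to the standard basis if for every $p\in\mathcal P'(A)$, with $t=t_p(A)$, there are $\alpha_{pij}(A)\in\mathbb{Z}_p$ ($1\le i\le t<j\le n$) with $\overline G_{A,p}=\operatorname{Span}_{\mathbb{Q}_p}(\mathbf x_{p1},\dots,\mathbf x_{pt})\oplus\operatorname{Span}_{\mathbb{Z}_p}(\mathbf e_{t+1},\dots,\mathbf e_n)$, $\mathbf x_{pi}=\mathbf e_i+\sum_{j>t}\alpha_{pij}(A)\mathbf e_j$. Condition $(A,B,p)$ on $T=(\gamma_{kj})$, $t=t_p(B)$: $\gamma_{kj}-\sum_{i=1}^{t}\gamma_{ij}\alpha_{pik}(B)\in\mathbb{Z}_p$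 for all $k,j\in\{t+1,\dots,n\}$; condition $(B,A,p)$ on $T^{-1}$ is the same with $A,B$ exchanged and $T^{-1}$ in place of $T$. *)

(* Defs.v *)
From HB Require Import structures.
From mathcomp Require Import all_boot all_order all_algebra all_field.
From mathcomp Require Import boolp classical_sets.

Set Implicit Arguments.
Unset Strict Implicit.
Unset Printing Implicit Defensive.

Import Order.TTheory GRing.Theory Num.Theory.

Local Open Scope classical_set_scope.
Local Open Scope ring_scope.

Definition prime_number := {p : nat | prime p}.

(** * The p-adic integers, as the inverse limit of the rings Z/p^k.
    An element is the sequence of its canonical residues: [zp_res x k] lies in
    {0, ..., p^k - 1} (see [zp_mod]) and represents x modulo p^k. *)

Section PadicIntegers.
Variable p : prime_number.

Local Notation P k := ((val p ^ k)%N%:Z).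

Record padic_int : Type := PadicInt {
  zp_res :> nat -> int;
  zp_resP : forall k, (zp_res k.+1 %% P k)%Z = zp_res k
}.

Lemma zp_ext (x y : padic_int) : (forall k, x k = y k) -> x = y.
Proof.
case: x y => [x xP] [y yP] /= exy; have {}exy: x = y by apply: funext.
by rewrite -exy in yP *; congr PadicInt; apply: Prop_irrelevance.
Qed.

Lemma zp_mod (x : padic_int) k : (x k %% P k)%Z = x k.
Proof. by rewrite -{1}(zp_resP x k) modz_mod zp_resP. Qed.

Lemma modz_pow (a : int) k m : (k <= m)%N ->
  ((a %% P m)%Z %% P k)%Z = (a %% P k)%Z.
Proof.
move=> km; rewrite [in RHS](divz_eq a (P m)) -(subnK km) expnD PoszM mulrA.
by rewrite modzMDl.
Qed.

Lemma zp_res_le (x : padic_int) k m : (k <= m)%N -> (x m %% P k)%Z = x k.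
Proof.
elim: m => [|m IH]; first by rewrite leqn0 => /eqP ->; rewrite zp_mod.
rewrite leq_eqVlt ltnS => /predU1P[->|km]; first by rewrite zp_mod.
by rewrite -(modz_pow _ km) zp_resP IH.
Qed.

Definition coherent (f : nat -> int) :=
  forall k, (f k.+1 %% P k)%Z = (f k %% P k)%Z.

Lemma zp_of_subproof f (fP : coherent f) k :
  ((f k.+1 %% P k.+1)%Z %% P k)%Z = (f k %% P k)%Z.
Proof. by rewrite modz_pow. Qed.

Definition zp_of f (fP : coherent f) : padic_int :=
  @PadicInt (fun k => (f k %% P k)%Z) (zp_of_subproof fP).

Lemma zp_const_coherent (a : int) : coherent (fun=> a).
Proof. by []. Qed.

Lemma zp_opp_coherent (x : padic_int) : coherent (fun k => - x k).
Proof. by move=> k; rewrite -modzNm zp_resP. Qed.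

Lemma zp_add_coherent (x y : padic_int) : coherent (fun k => x k + y k).
Proof. by move=> k; rewrite -modzDm !zp_resP. Qed.

Lemma zp_mul_coherent (x y : padic_int) : coherent (fun k => x k * y k).
Proof. by move=> k; rewrite -modzMm !zp_resP. Qed.

Definition zp_int (a : int) : padic_int := zp_of (zp_const_coherent a).
Definition zp_opp (x : padic_int) : padic_int := zp_of (zp_opp_coherent x).
Definition zp_add (x y : padic_int) : padic_int := zp_of (zp_add_coherent x y).
Definition zp_mul (x y : padic_int) : padic_int := zp_of (zp_mul_coherent x y).

HB.instance Definition _ := gen_eqMixin padic_int.
HB.instance Definition _ := gen_choiceMixin padic_int.

Lemma zp_addA : associative zp_add.
Proof.
by move=> x y z; apply: zp_ext => k /=; rewrite modzDmr modzDml addrA.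
Qed.

Lemma zp_addC : commutative zp_add.
Proof. by move=> x y; apply: zp_ext => k /=; rewrite addrC. Qed.

Lemma zp_add0 : left_id (zp_int 0) zp_add.
Proof. by move=> x; apply: zp_ext => k /=; rewrite modzDml add0r zp_mod. Qed.

Lemma zp_addN : left_inverse (zp_int 0) zp_opp zp_add.
Proof. by move=> x; apply: zp_ext => k /=; rewrite modzDml addNr. Qed.

HB.instance Definition _ :=
  GRing.isZmodule.Build padic_int zp_addA zp_addC zp_add0 zp_addN.

Lemma zp_mulA : associative zp_mul.
Proof.
by move=> x y z; apply: zp_ext => k /=; rewrite modzMmr modzMml mulrA.
Qed.

Lemma zp_mulC : commutative zp_mul.
Proof. by move=> x y; apply: zp_ext => k /=; rewrite mulrC. Qed.

Lemma zp_mul1 : left_id (zp_int 1) zp_mul.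
Proof. by move=> x; apply: zp_ext => k /=; rewrite modzMml mul1r zp_mod. Qed.

Lemma zp_mulDl : left_distributive zp_mul zp_add.
Proof.
by move=> x y z; apply: zp_ext => k /=; rewrite modzMml mulrDl modzDm.
Qed.

Lemma zp_oner_neq0 : zp_int 1 != zp_int 0.
Proof.
apply/eqP => /(congr1 (fun x : padic_int => x 1%N)) /=.
by rewrite mod0z modz_small // expn1 ltz_nat prime_gt1 // (valP p).
Qed.

HB.instance Definition _ := GRing.Zmodule_isComNzRing.Build padic_int
  zp_mulA zp_mulC zp_mul1 zp_mulDl zp_oner_neq0.

Definition zp_unit : pred padic_int :=
  fun x => `[< exists y : padic_int, y * x = 1 >].

Definition zp_inv (x : padic_int) : padic_int :=
  if pselect (exists y : padic_int, y * x = 1) is left ex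
  then projT1 (cid ex) else x.

Lemma zp_mulVx : {in zp_unit, left_inverse 1 zp_inv *%R}.
Proof.
move=> x /asboolP ex; rewrite /zp_inv; case: pselect => // ex'.
exact: (projT2 (cid ex')).
Qed.

Lemma zp_unitPl (x y : padic_int) : y * x = 1 -> zp_unit x.
Proof. by move=> yx; apply/asboolP; exists y. Qed.

Lemma zp_inv_out : {in [predC zp_unit], zp_inv =1 id}.
Proof. by move=> x /asboolPn nex; rewrite /zp_inv; case: pselect. Qed.

HB.instance Definition _ := GRing.ComNzRing_hasMulInverse.Build padic_int
  zp_mulVx zp_unitPl zp_inv_out.

Lemma zp_neq0 (x : padic_int) : x != 0 -> exists k, ~~ (P k %| x k)%Z.
Proof.
move=> x0; apply: contrapT => /forallNP nk; case/eqP: x0.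
apply: zp_ext => k /=; rewrite mod0z.
by have /negP/negPn/dvdz_mod0P := nk k; rewrite zp_mod.
Qed.

Lemma prime_pow_dvdM (a b k l : nat) : (val p ^ (k + l) %| a * b)%N ->
  (val p ^ k %| a)%N || (val p ^ l %| b)%N.
Proof.
have pp := valP p; case: (posnP a) => [->|a0]; first by rewrite dvdn0.
case: (posnP b) => [->|b0]; first by rewrite dvdn0 orbT.
rewrite !pfactor_dvdn ?muln_gt0 ?a0 // lognM //.
case: (leqP k (logn (val p) a)) => //= lt_ak le_kl; rewrite leqNgt.
by apply/negP => /ltnW/(leq_add lt_ak); rewrite addSn ltnNge le_kl.
Qed.

Lemma zp_mulf_eq0 : GRing.integral_domain_axiom padic_int.
Proof.
move=> x y xy0; apply/negPn/negP; rewrite negb_or.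
case/andP => /zp_neq0[k xk] /zp_neq0[l yl].
have := congr1 (fun z : padic_int => z (k + l)%N) xy0.
rewrite /= mod0z => /dvdz_mod0P; rewrite dvdzE abszM => /prime_pow_dvdM.
case/orP => [dv|dv].
  by case/negP: xk; rewrite -(zp_res_le x (leq_addr l k))
    (dvdz_mod0P (_ : _ %| _)%Z) ?dvdz0.
by case/negP: yl; rewrite -(zp_res_le y (leq_addl k l))
    (dvdz_mod0P (_ : _ %| _)%Z) ?dvdz0.
Qed.

HB.instance Definition _ :=
  GRing.ComUnitRing_isIntegral.Build padic_int zp_mulf_eq0.

End PadicIntegers.

Notation padic p := {fraction (padic_int p)}.

Definition padic_int_in (p : prime_number) : set (padic p) :=
  range (fun a : padic_int p => tofrac a).
Arguments padic_int_in p : clear implicits.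

(** * Spans and sums of sets of column vectors *)

(* All finite linear combinations of elements of X with coefficients in S; for
   S a subring of F this is the S-submodule of F^n generated by X. *)
Definition lin_span (F : fieldType) (S : set F) n (X : set 'cV[F]_n) :
    set 'cV[F]_n :=
  [set v | exists (m : nat) (c : 'I_m -> F) (x : 'I_m -> 'cV[F]_n),
     (forall i, S (c i) /\ X (x i)) /\ v = \sum_(i < m) c i *: x i].

Definition is_direct_sum (V : zmodType) (W U1 U2 : set V) : Prop :=
  W = [set u | exists u1 u2, [/\ U1 u1, U2 u2 & u = u1 + u2]] /\
  U1 `&` U2 = [set 0].

Definition mx_image (R : pzRingType) m n (T : 'M[R]_(m, n))
    (X : set 'cV[R]_n) : set 'cV[R]_m :=
  [set T *m x | x in X].

(** * The group G_A and its invariants *)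

Section Invariants.
Variable n : nat.
Implicit Types (A B : 'M[int]_n.+1) (T : 'M[rat]_n.+1) (p : prime_number).

Definition ratM A : 'M[rat]_n.+1 := map_mx intr A.

Definition Ggroup A : set 'cV[rat]_n.+1 :=
  [set v | exists (k : int) (x : 'cV[int]_n.+1),
     v = (ratM A ^ (- k)) *m map_mx intr x].

Definition char_poly_mod p A : {poly 'F_(val p)} := map_poly intr (char_poly A).

Definition tmult p A : nat := mup 0 (char_poly_mod p A).

Definition Pset A : set prime_number := [set p | ((val p)%:Z %| \det A)%Z].

Definition Pset' A : set prime_number :=
  [set p | Pset A p /\ char_poly_mod p A <> 'X^(n.+1)].

(* Z[1/det A] *)
Definition Rring A : set rat :=
  range (fun f : {poly int} => (map_poly intr f).[((\det A)%:~R : rat)^-1]).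

Definition inGL (R : set rat) T : Prop :=
  exists S : 'M[rat]_n.+1,
    [/\ forall i j, R (T i j), forall i j, R (S i j),
        T *m S = 1%:M & S *m T = 1%:M].

Definition Gbar A p : set 'cV[padic p]_n.+1 :=
  lin_span (padic_int_in p) [set map_mx ratr v | v in Ggroup A].

(* Indices start at 0, so that i <= t and j > t become i < t and t <= j.
   Only the entries [a i j] with i < t <= j are ever used. *)
Definition char_vec p (t : nat) (a : 'M[padic_int p]_n.+1) (i : 'I_n.+1) :
    'cV[padic p]_n.+1 :=
  delta_mx i 0 + \sum_(j < n.+1 | (t <= j)%N) tofrac (a i j) *: delta_mx j 0.

Definition is_characteristic A (alpha : forall p, 'M[padic_int p]_n.+1) :
    Prop :=
  forall p, Pset' A p ->
    let t := tmult p A in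
    is_direct_sum (@Gbar A p)
      (lin_span setT
        [set char_vec t (alpha p) i | i in [set i : 'I_n.+1 | (i < t)%N]])
      (lin_span (padic_int_in p)
        [set (delta_mx j 0 : 'cV_n.+1) | j in [set j : 'I_n.+1 | (t <= j)%N]]).

(* With [alpha] the coefficients of B, this is condition (A, B, p) on T; its
   formula mentions neither A nor its coefficients. *)
Definition padic_condition B (alpha : forall p, 'M[padic_int p]_n.+1) p T :
    Prop :=
  let t := tmult p B in
  forall k j : 'I_n.+1, (t <= k)%N -> (t <= j)%N ->
    padic_int_in p (ratr (T k j) -
      \sum_(i < n.+1 | (i < t)%N) ratr (T i j) * tofrac (alpha p i k)).

End Invariants.
Arguments Gbar {n} A p.

(** * Rings of integers of number fields *)

Section RingOfIntegers.
Variable K : fieldExtType rat.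

Definition alg_integer : pred K :=
  fun x => `[< integralOver (intr : int -> K) x >].

Lemma alg_integer_subring : subring_closed alg_integer.
Proof.
split.
- by apply/asboolP; apply: integral1.
- by move=> x y /asboolP xO /asboolP yO; apply/asboolP; apply: integral_sub.
- by move=> x y /asboolP xO /asboolP yO; apply/asboolP; apply: integral_mul.
Qed.

HB.instance Definition _ :=
  GRing.isSubringClosed.Build K alg_integer alg_integer_subring.

Record ring_of_integers := RingOfIntegers {
  int_val :> K;
  _ : int_val \in alg_integer
}.

HB.instance Definition _ := [isSub for int_val].
HB.instance Definition _ := [Choice of ring_of_integers by <:].
HB.instance Definition _ :=
  [SubChoice_isSubComNzRing of ring_of_integers by <:].

Definition lies_above (I : prime_idealr ring_of_integers) (p : nat) : Prop :=
  forall m : int, (m%:~R \in I) = (p%:Z %| m)%Z.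

Variable n : nat.

Definition gen_eigenvector (A : 'M[K]_n.+1) (a : K) (v : 'cV[K]_n.+1) : Prop :=
  v != 0 /\ exists m : nat, (A - a%:M) ^+ m *m v = 0.

(* [eigenvalue] is about row vectors, hence the transpose. *)
Definition Xspace (A : 'M[int]_n.+1) (I : prime_idealr ring_of_integers) :
    set 'cV[K]_n.+1 :=
  let AK := map_mx intr A in
  lin_span setT [set v | exists a : ring_of_integers,
    [/\ a \in I, eigenvalue AK^T (int_val a) &
        gen_eigenvector AK (int_val a) v]].

End RingOfIntegers.

(* Main.v *)
(** G_A consists of the rational vectors that some power of A makes integral.
    The same recipe over a subring S of a field F defines an S-module [lat],
    which recovers the Z_p-module generated by G_A for S = Z_p, and a largest
    F-subspace [dvs] of it. Since T maps G_A onto G_B if and only if it does so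
    after localizing at every prime p, everything is read off [lat] and [dvs].

    Let S be the localization of O_K at a prime I above p. Eigenvalues outside I
    are units of S, and those in I have a power in p S (reduce an integral
    equation modulo p). Hence X_{A,I} is exactly [dvs], which makes the condition
    on X necessary, and p^r [lat] is contained in [dvs] + S^n for some r.

    Conversely, no completion of K is needed. The characteristic of A gives, for
    v in G_A and every m, a decomposition v = sum_j a_j e_j + p^m w with j > t,
    a_j integers and w locally in G_A; T e_j is locally in G_B by the p-adic
    condition, and T (p^m w) is so for m large, because T X_{A,I} is contained in
    X_{B,I}. *)

Require Import Defs.
From HB Require Import structures.
From mathcomp Require Import all_boot all_order all_algebra all_field.
From mathcomp Require Import boolp classical_sets ring.

Set Implicit Arguments.
Unset Strict Implicit.
Unset Printing Implicit Defensive.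

Import Order.TTheory GRing.Theory Num.Theory.

Local Open Scope classical_set_scope.
Local Open Scope ring_scope.

(** * Lattices attached to a matrix over a subring *)

Section LatticeDef.
Variables (F : fieldType) (S : {pred F}) (n : nat).
Implicit Types (M : 'M[F]_n.+1) (v : 'cV[F]_n.+1).

Definition lat M v : Prop := exists k, M ^+ k *m v \is a mxOver S.

Definition dvs M v : Prop := forall c, lat M (c *: v).

End LatticeDef.

Section Lattice.
Variables (F : fieldType) (S : subringClosed F) (n : nat).
Implicit Types (M : 'M[F]_n.+1) (v : 'cV[F]_n.+1).
Local Notation lat := (lat S).
Local Notation dvs := (dvs S).

Lemma map_int_over m k (M : 'M[int]_(m, k)) :
  (map_mx intr M : 'M[F]_(m, k)) \is a mxOver S.
Proof. by apply/mxOverP => i j; rewrite mxE rpred_int. Qed.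

Lemma mxOver_adj M : M \is a mxOver S -> \adj M \is a mxOver S.
Proof.
move=> /mxOverP MS; apply/mxOverP => i j; rewrite mxE.
apply: rpredM; first by rewrite rpredX ?rpredN1.
apply: rpred_sum => s _; apply: rpredM; first by rewrite rpredX ?rpredN1.
by apply: rpred_prod => k _; rewrite !mxE.
Qed.

Lemma mxOverX M k : M \is a mxOver S -> M ^+ k \is a mxOver S.
Proof. by move=> MS; apply: rpredX. Qed.

Lemma lat_le M v k l : M \is a mxOver S -> (k <= l)%N ->
  M ^+ k *m v \is a mxOver S -> M ^+ l *m v \is a mxOver S.
Proof.
move=> MS kl kS; rewrite -(subnK kl) exprD -mulmxA.
by apply: mxOverM => //; apply: mxOverX.
Qed.

Lemma lat_over M v : v \is a mxOver S -> lat M v.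
Proof. by exists 0%N; rewrite expr0 mul1mx. Qed.

Lemma lat0 M : lat M 0.
Proof. by apply: lat_over; apply/mxOverP => i j; rewrite mxE rpred0. Qed.

Lemma latZ M v c : c \in S -> lat M v -> lat M (c *: v).
Proof. by move=> cS [k kS]; exists k; rewrite -scalemxAr mxOverZ. Qed.

Lemma dvs_lat M v : dvs M v -> lat M v.
Proof. by move=> /(_ 1); rewrite scale1r. Qed.

Lemma dvsZ M v c : dvs M v -> dvs M (c *: v).
Proof. by move=> vD d; rewrite scalerA; apply: vD. Qed.

Lemma dvs0 M : dvs M 0.
Proof. by move=> c; rewrite scaler0; apply: lat0. Qed.

Section Over.
Variable M : 'M[F]_n.+1.
Hypothesis MS : M \is a mxOver S.

Lemma latD v w : lat M v -> lat M w -> lat M (v + w).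
Proof.
move=> [k kS] [l lS]; exists (maxn k l); rewrite mulmxDr.
by apply: rpredD; [apply: lat_le kS | apply: lat_le lS]; rewrite // (leq_maxl, leq_maxr).
Qed.

Lemma latN v : lat M v -> lat M (- v).
Proof. by move=> vL; rewrite -scaleN1r; apply: latZ; rewrite ?rpredN1. Qed.

Lemma lat_sum I r (P : pred I) (f : I -> 'cV_n.+1) :
  (forall i, P i -> lat M (f i)) -> lat M (\sum_(i <- r | P i) f i).
Proof.
move=> fL; elim/big_rec: _ => [|i x Pi]; first exact: lat0.
by apply: latD; apply: fL.
Qed.

Lemma lat_mul v : lat M v -> lat M (M *m v).
Proof.
move=> [k kS]; exists k; rewrite mulmxA -[M ^+ k *m M]exprSr.
by apply: lat_le kS.
Qed.

Lemma lat_pow k v : lat M (M ^+ k *m v) <-> lat M v.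
Proof.
split=> [[l]|[l lS]]; first by rewrite mulmxA -[M ^+ l *m _]exprD; exists (l + k)%N.
exists l; rewrite mulmxA -[M ^+ l *m _]exprD.
by apply: lat_le lS; rewrite // leq_addr.
Qed.

Lemma dvsD v w : dvs M v -> dvs M w -> dvs M (v + w).
Proof. by move=> vD wD c; rewrite scalerDr; apply: latD. Qed.

Lemma dvs_mul v : dvs M v -> dvs M (M *m v).
Proof. by move=> vD c; rewrite scalemxAr; apply: lat_mul. Qed.

Lemma dvs_horner p v : dvs M v -> dvs M (horner_mx M p *m v).
Proof.
elim/poly_ind: p v => [|p c IH] v vD.
  by rewrite rmorph0 mul0mx; apply: dvs0.
rewrite rmorphD rmorphM /= horner_mx_X horner_mx_C mulmxDl.
rewrite -mulmxA mul_scalar_mx.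
by apply: dvsD; [apply: IH; apply: dvs_mul | apply: dvsZ].
Qed.

(** The adjugate formula puts the inverse of M over S, so the powers of M can be stripped off one at
    a time. *)
Lemma lat_det_inv v : \det M != 0 -> (\det M)^-1 \in S ->
  lat M v -> v \is a mxOver S.
Proof.
move=> dM diS [k]; elim: k => [|k IH]; first by rewrite expr0 mul1mx.
rewrite exprS -mulmxA => kS; apply: IH.
have Mu : M \in unitmx by rewrite unitmxE unitfE.
rewrite -[_ *m v](mulKmx Mu); apply: mxOverM => //.
by rewrite /invmx Mu mxOverZ // mxOver_adj.
Qed.

End Over.
End Lattice.

(* For S the localization at a prime I, these are the elements of I and the
   units of S. *)
Definition small (F : fieldType) (S : {pred F}) (pi a : F) : Prop :=
  exists k, a ^+ k / pi \in S.

Definition large (F : fieldType) (S : {pred F}) (a : F) : Prop :=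
  [/\ a != 0, a \in S & a^-1 \in S].

(** * Small and large eigenvalues: the divisible part of the lattice and its complement *)

Section SmallLarge.
Variables (F : fieldType) (S : subringClosed F) (pi : F).
Hypotheses (piS : pi \in S) (pi0 : pi != 0) (piVS : pi^-1 \notin S).
Hypothesis piK : forall x, exists m, pi ^+ m * x \in S.

Local Notation small := (small S pi).
Local Notation large := (large S).

Lemma clear_denominators m n (M : 'M[F]_(m, n)) :
  exists r, pi ^+ r *: M \is a mxOver S.
Proof.
have /choice[r rS] (ij : 'I_m * 'I_n) : exists r, pi ^+ r * M ij.1 ij.2 \in S.
  exact: piK.
exists (\sum_ij r ij)%N; apply/mxOverP => i j; rewrite mxE.
rewrite (bigD1 (i, j)) //= addnC exprD -mulrA.
by apply: rpredM; rewrite ?rpredX // (rS (i, j)).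
Qed.

Variable n : nat.
Variable M : 'M[F]_n.+1.
Hypothesis MS : M \is a mxOver S.
Implicit Type v : 'cV[F]_n.+1.

Lemma lat_shift v : exists r, lat S M (pi ^+ r *: v).
Proof. by have [r rS] := clear_denominators v; exists r; apply: lat_over. Qed.

(* Write a^k = pi mu with mu in S. If pi^(m+1) u is in [lat], then so is
   M^k (pi^m u), being congruent to mu pi^(m+1) u modulo [dvs]; hence pi^m u is. *)
Lemma dvs_small_step a v : small a ->
  dvs S M (M *m v - a *: v) -> dvs S M v.
Proof.
move=> [k akS] wD.
(* [M - a] divides [M^k - a^k] among the polynomials in M, and [dvs] is stable under these. *)
have {}wD : dvs S M (M ^+ k *m v - a ^+ k *: v).
  have := congr1 (horner_mx M) (subrXX 'X a%:P k).
  rewrite mulrC -polyC_exp !(rmorphB, rmorphM) /= rmorphXn /=.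
  rewrite horner_mx_X !horner_mx_C => /(congr1 (mulmx^~ v)).
  rewrite mulmxBl mul_scalar_mx -mulmxA mulmxBl mul_scalar_mx => ->.
  exact: dvs_horner.
suff down m (u : 'cV[F]_n.+1) : lat S M (pi ^+ m *: u) ->
    dvs S M (M ^+ k *m u - a ^+ k *: u) -> lat S M u.
  move=> c; have [r rL] := lat_shift (c *: v); apply: down rL _.
  rewrite -scalemxAr scalerA mulrC -scalerA -scalerBr; exact: dvsZ.
elim: m => [|m IH] uL uD; first by rewrite expr0 scale1r in uL.
apply: (IH _ uD); apply: (iffLR (lat_pow MS k _)).
rewrite -scalemxAr -[M ^+ k *m u](subrK (a ^+ k *: u)) scalerDr.
apply: (latD MS); first by apply: dvs_lat; apply: dvsZ.
have -> : pi ^+ m *: (a ^+ k *: u) = (a ^+ k / pi) *: (pi ^+ m.+1 *: u).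
  by rewrite !scalerA exprS mulrA divfK // mulrC.
by apply: latZ akS uL.
Qed.

Definition roots_poly (s : seq F) : {poly F} := \prod_(a <- s) ('X - a%:P).

Lemma coprimep_roots_poly s t : (forall a, a \in s -> a \notin t) ->
  coprimep (roots_poly s) (roots_poly t).
Proof.
move=> st; rewrite {2}/roots_poly big_seq.
elim/big_rec: _ => [|b q bt IH]; first by rewrite coprimep1.
rewrite coprimepMr IH andbT coprimep_XsubC root_prod_XsubC.
by apply: contraL bt; apply: st.
Qed.

Lemma roots_poly_cons a s v :
  horner_mx M (roots_poly (a :: s)) *m v =
  horner_mx M (roots_poly s) *m (M *m v - a *: v).
Proof.
rewrite /roots_poly big_cons mulrC rmorphM rmorphB /= horner_mx_X horner_mx_C.
by rewrite -mulmxA mulmxBl mul_scalar_mx.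
Qed.

Lemma horner_mx_mulC p v :
  horner_mx M p *m (M *m v) = M *m (horner_mx M p *m v).
Proof.
have := congr1 (horner_mx M) (mulrC p 'X).
rewrite !rmorphM /= horner_mx_X => /(congr1 (mulmx^~ v)).
by rewrite -!mulmxA.
Qed.

Lemma horner_mx_mulXC p k v :
  horner_mx M p *m (M ^+ k *m v) = M ^+ k *m (horner_mx M p *m v).
Proof.
elim: k => [|k IH]; first by rewrite expr0 !mul1mx.
by rewrite exprS -!mulmxA horner_mx_mulC IH.
Qed.

Lemma horner_mxM_mul p q v :
  horner_mx M (p * q) *m v = horner_mx M p *m (horner_mx M q *m v).
Proof. by rewrite rmorphM -mulmxA. Qed.

Lemma char_poly_mul_eq0 p v : horner_mx M (p * char_poly M) *m v = 0.
Proof. by rewrite horner_mxM_mul Cayley_Hamilton mul0mx mulmx0. Qed.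

(** The roots are peeled off one by one: induction puts [M v - a v] in [dvs], and [dvs_small_step]
    passes from there to v. *)
Lemma dvs_small s v : (forall a, a \in s -> small a) ->
  horner_mx M (roots_poly s) *m v = 0 -> dvs S M v.
Proof.
elim: s v => [|a s IH] v sm.
  by rewrite /roots_poly big_nil rmorph1 mul1mx => ->; apply: dvs0.
rewrite roots_poly_cons => /IH h; apply: (dvs_small_step (sm a _)).
  by rewrite mem_head.
by apply: h => b bs; apply: sm; rewrite inE bs orbT.
Qed.

(** On the part of the space where all eigenvalues are units of S, M can be inverted over S. An
    outer induction removes the powers of M, so that only the passage from [M v] to v remains. *)
Lemma over_large s v : (forall a, a \in s -> large a) ->
  horner_mx M (roots_poly s) *m v = 0 -> lat S M v -> v \is a mxOver S.
Proof.
move=> lg gv [k]; elim: k v gv => [|k IH] v gv; first by rewrite expr0 mul1mx.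
rewrite exprSr -mulmxA => /IH MvS.
have {IH}MvS : M *m v \is a mxOver S.
  by apply: MvS; rewrite horner_mx_mulC gv mulmx0.
(* Inner induction on the roots: [w = M v - a v] is killed by one factor less, hence is over S, and
   [v = a^-1 (M v - w)]. *)
elim: s v lg gv MvS => [|a s IH] v lg.
  rewrite /roots_poly big_nil rmorph1 mul1mx => -> _.
  by apply/mxOverP => i j; rewrite mxE rpred0.
rewrite roots_poly_cons => gv MvS.
have [a0 aS aVS] : large a by apply: lg; rewrite mem_head.
have wS : M *m v - a *: v \is a mxOver S.
  apply: IH gv _ => [b bs|]; first by apply: lg; rewrite inE bs orbT.
  rewrite mulmxBr -scalemxAr.
  by apply: rpredB; [apply: mxOverM | apply: mxOverZ].
have -> : v = a^-1 *: (M *m v - (M *m v - a *: v)).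
  by rewrite opprB addrC subrK scalerA mulVf ?scale1r.
by apply: mxOverZ => //; apply: rpredB.
Qed.

(** By [over_large] every multiple of v is over S; a nonzero coordinate could be scaled to [pi^-1],
    which is not in S. *)
Lemma dvs_large_eq0 s v : (forall a, a \in s -> large a) ->
  horner_mx M (roots_poly s) *m v = 0 -> dvs S M v -> v = 0.
Proof.
move=> lg gv vD; apply/colP => i; rewrite mxE; apply/eqP/negPn/negP => vi0.
have /mxOverP/(_ i 0) : (pi^-1 / v i 0) *: v \is a mxOver S.
  by apply: over_large lg _ _; [rewrite -scalemxAr gv scaler0 | apply: vD].
by rewrite mxE divfK // (negPf piVS).
Qed.

Variables s1 s2 : seq F.
Hypotheses (sm1 : forall a, a \in s1 -> small a)
  (lg2 : forall a, a \in s2 -> large a)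
  (s12 : char_poly M = roots_poly s1 * roots_poly s2).

Lemma small_not_large a : small a -> large a -> False.
Proof.
move=> [k akS] [a0 aS aVS]; case/negP: piVS.
by rewrite -[pi^-1](mulKf (expf_neq0 k a0)) rpredM // -exprVn rpredX.
Qed.

Lemma small_large_coprime : coprimep (roots_poly s1) (roots_poly s2).
Proof.
apply: coprimep_roots_poly => a as1; apply/negP => as2.
exact: small_not_large (sm1 as1) (lg2 as2).
Qed.

(** For v in [dvs], its image under the small factor of the characteristic polynomial is still in
    [dvs] and, by Cayley-Hamilton, is killed by the large factor; so it vanishes by
    [dvs_large_eq0]. *)
Lemma dvs_kernel v : dvs S M v <-> horner_mx M (roots_poly s1) *m v = 0.
Proof.
split=> [vD|]; last exact: dvs_small.
apply: (@dvs_large_eq0 s2) => //; last exact: dvs_horner.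
by rewrite -horner_mxM_mul mulrC -s12 -[char_poly M]mul1r char_poly_mul_eq0.
Qed.

(** Take a Bezout relation [u f + w g = 1] between the small factor f and the large factor g, and
    let [pi^r] clear the denominators of [(u f)(M)]. The part of v coming from [w g] is killed by f,
    so it is in [dvs]; the part coming from [u f] is killed by g and, after multiplication by
    [pi^r], is still in [lat], so [over_large] applies. *)
Lemma lat_bounded_mod_dvs : exists r, forall v, lat S M v ->
  exists x y, [/\ dvs S M x, y \is a mxOver S & pi ^+ r *: v = x + y].
Proof.
have /Bezout_eq1_coprimepP[[u w] /= uw] := small_large_coprime.
have [r rS] := clear_denominators (horner_mx M (u * roots_poly s1)).
exists r => v vL; set f := roots_poly s1 in uw rS *; set g := roots_poly s2 in uw *.
exists (pi ^+ r *: (horner_mx M (w * g) *m v)), (pi ^+ r *: (horner_mx M (u * f) *m v)).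
split.
- apply: dvsZ; apply/dvs_kernel.
  by rewrite -horner_mxM_mul mulrCA -s12 char_poly_mul_eq0.
- apply: over_large lg2 _ _.
    rewrite -scalemxAr -horner_mxM_mul mulrCA [_ * f]mulrC -s12.
    by rewrite char_poly_mul_eq0 scaler0.
  rewrite scalemxAl; case: vL => k kS; exists k.
  have -> : M ^+ k *m (pi ^+ r *: horner_mx M (u * f) *m v) =
      (pi ^+ r *: horner_mx M (u * f)) *m (M ^+ k *m v).
    by rewrite -!scalemxAl -scalemxAr horner_mx_mulXC.
  exact: mxOverM.
- by rewrite -scalerDr -mulmxDl -rmorphD /= addrC uw rmorph1 mul1mx.
Qed.

End SmallLarge.

(** * Localization of the ring of integers at a prime ideal *)

Section LinSpan.
Variables (F : fieldType) (S : set F) (n : nat).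
Implicit Types (X : set 'cV[F]_n) (v : 'cV[F]_n).

Lemma lin_span_min X (W : set 'cV[F]_n) : W 0 ->
    (forall u v, W u -> W v -> W (u + v)) ->
    (forall c x, S c -> X x -> W (c *: x)) ->
  forall v, lin_span S X v -> W v.
Proof.
move=> W0 WD WX v [m [c [x [cx ->]]]]; elim/big_rec: _ => // i u _.
by apply: WD; have [? ?] := cx i; apply: WX.
Qed.

Lemma lin_span0 X : lin_span S X 0.
Proof.
exists 0%N, (fun=> 0), (fun=> 0); split; first by case.
by rewrite big_ord0.
Qed.

Lemma lin_span_gen X c x : S c -> X x -> lin_span S X (c *: x).
Proof. by move=> Sc Xx; exists 1%N, (fun=> c), (fun=> x); rewrite big_ord1. Qed.

Lemma lin_spanD X u v :
  lin_span S X u -> lin_span S X v -> lin_span S X (u + v).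
Proof.
move=> [m1 [c1 [x1 [cx1 ->]]]] [m2 [c2 [x2 [cx2 ->]]]].
exists (m1 + m2)%N,
  (fun i => match split i with inl j => c1 j | inr j => c2 j end),
  (fun i => match split i with inl j => x1 j | inr j => x2 j end).
split; first by move=> i; case: (split i) => j.
rewrite big_split_ord /=; congr (_ + _); apply: eq_bigr => i _.
  by rewrite (unsplitK (inl i)).
by rewrite (unsplitK (inr i)).
Qed.

Lemma lin_span_sum X I r (P : pred I) (f : I -> 'cV[F]_n) :
  (forall i, P i -> lin_span S X (f i)) ->
  lin_span S X (\sum_(i <- r | P i) f i).
Proof.
move=> fX; elim/big_rec: _ => [|i u Pi uX]; first exact: lin_span0.
by apply: lin_spanD => //; apply: fX.
Qed.

End LinSpan.

(** * Decomposition into generalized eigenspaces *)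

Section GeneralizedEigenspaces.
Variables (F : fieldType) (n : nat) (M : 'M[F]_n.+1).

(* Primary decomposition, by splitting off one root at a time. *)
Lemma roots_poly_kernel (s : seq F) (W : set 'cV[F]_n.+1) : W 0 ->
    (forall u v, W u -> W v -> W (u + v)) ->
    (forall a m v, a \in s -> (M - a%:M) ^+ m *m v = 0 -> W v) ->
  forall v, horner_mx M (roots_poly s) *m v = 0 -> W v.
Proof.
move=> W0 WD; have [m] := ubnP (size s).
elim: m s => // m IH [|a s] sz Ws v.
  by rewrite /roots_poly big_nil rmorph1 mul1mx => ->.
set t := [seq b <- s | b != a].
(* The multiplicity of a in [a :: s]; the successor accounts for the head. *)
set k := (count (pred1 a) s).+1.
have sE : roots_poly (a :: s) = ('X - a%:P) ^+ k * roots_poly t.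
  rewrite /roots_poly big_cons exprS -mulrA; congr (_ * _).
  rewrite (bigID (pred1 a)) /=; congr (_ * _); last by rewrite big_filter.
  have sa : [seq b <- s | b == a] = nseq (count (pred1 a) s) a.
    by rewrite -size_filter; apply/all_pred1P; apply: filter_all.
  by rewrite -big_filter sa big_nseq iter_mulr_1.
have cop : coprimep (('X - a%:P) ^+ k) (roots_poly t).
  apply: coprimep_expl; rewrite coprimep_sym coprimep_XsubC root_prod_XsubC.
  by rewrite mem_filter eqxx.
have /Bezout_eq1_coprimepP[[u w] /= uw] := cop.
rewrite sE => gv.
have -> : v = horner_mx M (u * ('X - a%:P) ^+ k) *m v
            + horner_mx M (w * roots_poly t) *m v.
  by rewrite -mulmxDl -rmorphD /= uw rmorph1 mul1mx.
apply: WD.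
- apply: (IH t).
  + by rewrite /= ltnS in sz; apply: leq_ltn_trans sz; rewrite size_filter count_size.
  + move=> b j x; rewrite mem_filter => /andP[_ bs].
    by apply: Ws; rewrite inE bs orbT.
  by rewrite -horner_mxM_mul mulrCA [roots_poly t * _]mulrC horner_mxM_mul gv mulmx0.
- apply: (Ws a k); first by rewrite mem_head.
  have -> : (M - a%:M) ^+ k = horner_mx M (('X - a%:P) ^+ k).
    by rewrite rmorphXn rmorphB /= horner_mx_X horner_mx_C.
  by rewrite -horner_mxM_mul mulrCA horner_mxM_mul gv mulmx0.
Qed.

End GeneralizedEigenspaces.

(** * Arithmetic of the local ring at I inside K *)

Section Localization.
Variables (K : fieldExtType rat) (p : nat).
Variable I : prime_idealr (ring_of_integers K).
Local Notation O := (ring_of_integers K).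

Lemma int_val_inj : injective (@int_val K). Proof. exact: val_inj. Qed.
Lemma int_valM (a b : O) : int_val (a * b) = int_val a * int_val b.
Proof. exact: (rmorphM val). Qed.
Lemma int_valB (a b : O) : int_val (a - b) = int_val a - int_val b.
Proof. exact: (rmorphB val). Qed.
Lemma int_val0 : int_val (0 : O) = 0.
Proof. exact: (rmorph0 val). Qed.
Lemma int_val1 : int_val (1 : O) = 1.
Proof. exact: (rmorph1 val). Qed.
Lemma int_val_int m : int_val (m%:~R : O) = m%:~R.
Proof. exact: (rmorph_int val). Qed.
Lemma int_valX (a : O) k : int_val (a ^+ k) = int_val a ^+ k.
Proof. exact: (rmorphXn val). Qed.

Definition loc : pred K :=
  fun x => `[< exists a s : O, s \notin I /\ x * int_val s = int_val a >].

Lemma one_notin_ideal : 1 \notin I.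
Proof. by rewrite idealr1. Qed.

Lemma loc_subring : subring_closed loc.
Proof.
split.
- by apply/asboolP; exists 1, 1; rewrite one_notin_ideal mul1r.
- move=> x y /asboolP[a [s [sI xs]]] /asboolP[b [t [tI yt]]]; apply/asboolP.
  exists (a * t - b * s), (s * t); rewrite prime_idealrM negb_or sI tI; split=> //.
  by rewrite int_valB !int_valM mulrBl -xs -yt mulrA -!mulrA [int_val s * _]mulrC.
- move=> x y /asboolP[a [s [sI xs]]] /asboolP[b [t [tI yt]]]; apply/asboolP.
  exists (a * b), (s * t); rewrite prime_idealrM negb_or sI tI; split=> //.
  by rewrite !int_valM mulrACA xs yt.
Qed.

HB.instance Definition _ := GRing.isSubringClosed.Build K loc loc_subring.

Lemma loc_int (a : O) : int_val a \in loc.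
Proof. by apply/asboolP; exists a, 1; rewrite one_notin_ideal int_val1 mulr1. Qed.

Lemma ring_of_integers_root (a : O) :
  exists2 f : {poly int}, f \is monic & (map_poly intr f).[a] = 0.
Proof.
have [f fm fa] : integralOver (intr : int -> K) (int_val a).
  by apply/asboolP; exact: (valP a).
exists f => //; apply: int_val_inj.
rewrite -[int_val _]/(val _) -horner_map -map_poly_comp /=.
rewrite -[RHS](rootP fa); congr (_.[_]).
by apply: eq_map_poly => m /=; apply: int_val_int.
Qed.

(** Clearing denominators in the minimal polynomial gives an integer polynomial r with root x; its
    leading coefficient d makes [d x] integral. *)
Lemma integer_multiple (x : K) :
  exists (d : nat) (a : O), (0 < d)%N /\ d%:R * x = int_val a.
Proof.
have /polyOver1P[q qE] : minPoly 1%AS x \is a polyOver 1%VS by apply: minPolyOver.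
have [r [c c0 rE]] := rat_poly_scale q.
have r0 : r != 0.
  apply: contraTneq (monic_neq0 (monic_minPoly 1%AS x)) => r0.
  by rewrite qE rE r0 map_poly0 scaler0 map_poly0 eqxx.
have rx : root (map_poly intr r) x.
  have := root_minPoly 1%AS x; rewrite qE rE map_polyZ /= rootZ; last first.
    by rewrite ?scaler_eq0 ?fmorph_eq0 ?oner_eq0 ?orbF invr_eq0 intr_eq0.
  rewrite -map_poly_comp /=.
  have -> // : map_poly (GRing.in_alg K \o intr) r = map_poly intr r.
  by apply: eq_map_poly => m; apply: rmorph_int.
have d0 : lead_coef r != 0 by rewrite lead_coef_eq0.
set d := lead_coef r in d0.
have intr_inj : injective (intr : int -> K).
  by move=> i j; rewrite -!(rmorph_int (GRing.in_alg K)) => /fmorph_inj/intr_inj.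
have [n nE] : exists n, size r = n.+2.
  have : (1 < size r)%N.
    rewrite -(size_map_inj_poly intr_inj) //; apply: root_size_gt1 rx.
    have dK0 : d%:~R != 0 :> K by apply: contra_neq d0 => dK0; apply: intr_inj.
    by rewrite map_poly_eq0_id0.
  by case: (size r) => [|[|n]] // _; exists n.
suff yI : integralOver (intr : int -> K) (d%:~R * x).
  have dI : d%:~R * x \in @alg_integer K by apply/asboolP.
  have : `|d|%N%:R * x \in @alg_integer K.
    rewrite -[`|d|%N%:R]/((`|d|%N%:Z)%:~R) abszEsign rmorphM /= -mulrA.
    by rewrite rmorph_sign rpredM // rpredX // rpredN1.
  by move=> adI; exists `|d|%N, (RingOfIntegers adI); rewrite absz_gt0.
(* With r of degree n + 1, this is the monic polynomial [d^n r(X / d)], so that its value at [d x]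
   is [d^n r(x)]. *)
pose f : {poly int} :=
  \poly_(i < n.+2) (if i == n.+1 then 1 else r`_i * d ^+ (n - i)).
exists f.
  rewrite monicE /lead_coef size_poly_eq ?eqxx ?oner_eq0 //=.
  by rewrite coef_poly ltnSn eqxx.
apply/rootP; rewrite (@horner_coef_wide _ n.+2); last first.
  by rewrite (leq_trans (size_poly _ _)) // size_poly.
have /rootP := rx; rewrite (@horner_coef_wide _ n.+2); last first.
  by rewrite (leq_trans (size_poly _ _)) // nE.
move=> /(congr1 ( *%R (d%:~R ^+ n))); rewrite mulr0 => e; rewrite -[RHS]e.
rewrite mulr_sumr; apply: eq_bigr => i _.
rewrite !coef_map_id0 // coef_poly ltn_ord exprMn mulrA [RHS]mulrA; congr (_ * _).
have [->|ni] := eqVneq (val i) n.+1.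
  by rewrite mul1r exprSr /d /lead_coef nE.
have iln : (i <= n)%N by have := ltn_ord i; rewrite ltnS leq_eqVlt (negPf ni).
rewrite rmorphM rmorphXn /= -mulrA -exprD subnK //; exact: mulrC.
Qed.

Lemma natK_eq0 m : ((m%:R : K) == 0) = (m == 0%N).
Proof.
by rewrite -(rmorph_nat (GRing.in_alg K)) fmorph_eq0 pnatr_eq0.
Qed.

Hypotheses (p_pr : prime p) (Ip : lies_above I p).

Lemma p_neq0 : (p%:R : K) != 0.
Proof. by rewrite natK_eq0 -lt0n prime_gt0. Qed.

Lemma nat_in_ideal m : (m%:R \in I) = (p %| m)%N.
Proof. exact: (Ip m). Qed.

Lemma int_val_nat m : int_val (m%:R : O) = m%:R.
Proof. exact: (int_val_int m). Qed.

Lemma loc_p : (p%:R : K) \in loc.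
Proof. by rewrite rpred_nat. Qed.

Lemma loc_pV : (p%:R : K)^-1 \notin loc.
Proof.
apply/negP => /asboolP[a [s [sI ps]]]; case/negP: sI.
have -> : s = a * p%:R.
  apply: int_val_inj; rewrite int_valM int_val_nat -ps mulrAC mulVf ?mul1r //.
  exact: p_neq0.
by apply: idealMr; rewrite nat_in_ideal.
Qed.

(** Write a denominator of x as [u p^e] with u prime to p: u lies outside I, hence [p^e] is all that
    has to be cleared. *)
Lemma loc_clear (x : K) : exists m, p%:R ^+ m * x \in loc.
Proof.
have [d [a [d0 da]]] := integer_multiple x.
have [u pu dE] := pfactor_coprime p_pr d0.
move: (logn p d) dE => e dE; exists e; apply/asboolP; exists a, u%:R; split.
  by rewrite nat_in_ideal -prime_coprime.
by rewrite -da int_val_nat dE natrM natrX [u%:R * _]mulrC mulrAC.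
Qed.

(** If the denominator were [m p], a Bezout relation between numerator and denominator would read
    [p^-1 = m (u q + v)], contradicting [loc_pV]. *)
Lemma loc_rat (q : rat) : GRing.in_alg K q \in loc -> ~~ (p %| `|denq q|)%N.
Proof.
move=> qL; apply/negP => /dvdnP[m mE].
have /coprimezP[[u v] /= uv] : coprimez (numq q) (denq q) by exact: coprime_num_den.
have qE : (p%:R : rat)^-1 = m%:R * (u%:~R * q + v%:~R).
  have p0 : (p%:R : rat) != 0 by rewrite pnatr_eq0 -lt0n prime_gt0.
  have denE : (denq q)%:~R = m%:R * p%:R :> rat.
    by rewrite -natrM -mE -[in LHS](gez0_abs (ltW (denq_gt0 q))).
  have m0 : (m%:R : rat) != 0.
    apply: contraTneq (denq_neq0 q) => m0.
    by rewrite -(intr_eq0 rat) denE m0 mul0r eqxx.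
  rewrite -[q in X in _ = X]divq_num_den; apply: (mulIf p0); rewrite mulVf //.
  rewrite mulrAC -denE mulrDr mulrCA [_ / _]mulrC mulVKf ?intr_eq0 ?denq_neq0 //.
  by rewrite [_ * v%:~R]mulrC -!intrM -intrD uv.
case/negP: loc_pV; rewrite -(rmorph_nat (GRing.in_alg K)) -fmorphV qE.
rewrite rmorphM rmorphD rmorphM /= -!/(GRing.in_alg K _).
rewrite (rmorph_nat (GRing.in_alg K)) !(rmorph_int (GRing.in_alg K)).
by rewrite rpredM ?rpred_nat // rpredD ?rpred_int // rpredM ?rpred_int.
Qed.

(** Let f be a monic integer polynomial with root a, and k the least index whose coefficient is
    prime to p. Then [f = p h + X^k g'] with [g'(a)] congruent to that coefficient modulo I, hence
    outside I, and [a^k / p = - h(a) / g'(a)]. *)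
Lemma ideal_small (a : O) : a \in I -> small loc p%:R (int_val a).
Proof.
move=> aI.
have [f fm fa] := ring_of_integers_root a.
have [k pk mink] : exists2 k, ~~ (p%:Z %| f`_k)%Z &
    forall i, (i < k)%N -> (p%:Z %| f`_i)%Z.
  have ex : exists k, ~~ (p%:Z %| f`_k)%Z.
    exists (size f).-1; move/monicP: fm; rewrite /lead_coef => ->.
    by rewrite dvdzE /= gtnNdvd // prime_gt1.
  exists (ex_minn ex); first by case: ex_minnP.
  by case: ex_minnP => m _ mm i im; apply: contraLR im => /mm; rewrite -leqNgt.
have [h hE] : exists h, take_poly k f = p%:Z *: h.
  exists (\poly_(i < k) (f`_i %/ p)%Z); apply/polyP => i.
  rewrite coef_take_poly coefZ coef_poly; case: ifP => ik; rewrite ?mulr0 //.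
  by rewrite mulrC divzK // mink.
have [g gE] : exists g, drop_poly k f = g * 'X + (f`_k)%:P.
  exists (drop_poly k.+1 f); apply/polyP => i.
  rewrite coefD coefMX coefC !coef_drop_poly; case: i => [|i] /=; rewrite ?add0r //.
  by rewrite addr0 addSnnS.
set G := (map_poly intr (drop_poly k f)).[a].
have GI : G \notin I.
  rewrite /G gE rmorphD rmorphM /= map_polyX map_polyC /= hornerD hornerMX hornerC.
  rewrite rpredDl; first by rewrite Ip.
  exact: idealMr.
have e : a ^+ k * G = - (p%:R * (map_poly intr h).[a]).
  apply/eqP; rewrite -addr_eq0 -fa -[in X in _ == X](poly_take_drop k f) hE.
  rewrite rmorphD rmorphM /= map_polyZ map_polyXn hornerD hornerM hornerZ hornerXn.
  by rewrite addrC [a ^+ k * G]mulrC.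
exists k; apply/asboolP; exists (- (map_poly intr h).[a]), G; split=> //.
apply: (mulfI p_neq0); rewrite mulrA [p%:R * _]mulrC divfK ?p_neq0 //.
by rewrite -int_valX -int_valM e -int_val_nat -int_valM mulrN.
Qed.

Lemma not_ideal_large (a : O) : a \notin I -> large loc (int_val a).
Proof.
move=> aI; have a0 : int_val a != 0.
  apply: contraNneq aI => a0.
  by have -> : a = 0 by [apply: int_val_inj; rewrite a0 int_val0]; rewrite rpred0.
split=> //; first exact: loc_int.
by apply/asboolP; exists 1, a; split; rewrite // int_val1 mulVf.
Qed.

End Localization.

(** * Primes above p and the spaces X *)

Section LyingOver.
Variables (K : fieldExtType rat) (p : nat).
Hypothesis p_pr : prime p.
Local Notation O := (ring_of_integers K).

Definition ideal_set (J : set O) : Prop :=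
  J 0 /\ forall a x y, J x -> J y -> J (a * x + y).

Lemma intr_O_inj : injective (intr : int -> O).
Proof.
move=> i j /(congr1 (@int_val K)); rewrite !int_val_int.
by rewrite -!(rmorph_int (GRing.in_alg K)) => /fmorph_inj/intr_inj.
Qed.

(** If [a p = 1], multiply a monic equation of degree k for a by [p^k]: the terms with [i < k]
    become integers divisible by [p^(k - i)] and the leading one becomes 1, so p would divide 1. *)
Lemma p_not_unit (a : O) : a * p%:R != 1.
Proof.
apply/eqP => ap1; have [f fm fa] := ring_of_integers_root a.
have := fa; rewrite (@horner_coef_wide _ (size f)) ?size_poly //.
have [k fk] : exists k, size f = k.+1.
  by case: (size f) (monic_neq0 fm) (size_poly_eq0 f) => [|k] /negPf -> // _; exists k.
rewrite fk big_ord_recr /= coef_map /= -[k]/(k.+1.-1) -fk.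
rewrite -/(lead_coef f) (monicP fm) mul1r.
rewrite fk /= => /(congr1 (fun x => x * p%:R ^+ k)).
rewrite mul0r mulrDl -exprMn ap1 expr1n mulr_suml.
have -> : \sum_(i < k) (map_poly intr f)`_i * a ^+ i * p%:R ^+ k
    = ((p%:Z) * \sum_(i < k) f`_i * p%:Z ^+ (k - i).-1)%:~R :> O.
  rewrite mulr_sumr rmorph_sum; apply: eq_bigr => i _.
  rewrite coef_map /= mulrCA -exprS prednK ?subn_gt0 // rmorphM rmorphXn /=.
  have -> : (p%:R : O) ^+ k = p%:R ^+ (k - i) * p%:R ^+ i.
    by rewrite -exprD subnK // ltnW.
  by rewrite -mulrA [a ^+ i * _]mulrCA -exprMn ap1 expr1n mulr1.
set m := _ * \sum_(i < k) _; rewrite -[1]/(1%:~R) -intrD => m1.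
have {m1} : m + 1 = 0 by apply: intr_O_inj.
move=> /eqP; rewrite addrC addr_eq0 => /eqP e.
have : (p%:Z %| - m)%Z by rewrite dvdzE abszN -dvdzE dvdz_mulr.
by rewrite -e dvdzE /= gtnNdvd // prime_gt1.
Qed.

Lemma maximal_ideal_above : exists J : set O,
  [/\ ideal_set J, J p%:R, ~ J 1 &
      forall J', ideal_set J' -> (J `<=` J')%classic -> ~ J' 1 -> (J' `<=` J)%classic].
Proof.
pose P (J : set O) := J = set0 \/ [/\ ideal_set J, J p%:R & ~ J 1].
have [F FP Ftot|J [PJ Jmax]] := @Zorn_bigcup O P.
  have [[J FJ]|F0] := pselect (exists2 J, F J & (exists x, J x)); last first.
    left; rewrite -subset0 => x [J FJ Jx]; case: F0; exists J => //; by exists x.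
  have pick G x : F G -> G x -> [/\ ideal_set G, G p%:R & ~ G 1].
    by move=> /FP[->|].
  move=> [x0 Jx0]; have [[J0 _] Jp _] := pick _ _ FJ Jx0.
  right; split; first split.
  - by exists J.
  - move=> a x y [G FG Gx] [H FH Hy].
    have [[_ Gi] _ _] := pick _ _ FG Gx; have [[_ Hi] _ _] := pick _ _ FH Hy.
    by have [GH|HG] := Ftot _ _ FG FH; [exists H => //; apply: Hi (GH _ Gx) Hy
      | exists G => //; apply: Gi Gx (HG _ Hy)].
  - by exists J.
  - by move=> [G FG G1]; have [_ _ /(_ G1)] := pick _ _ FG G1.
pose J0 : set O := [set x | exists a, x = a * p%:R].
have PJ0 : P J0.
  right; split; first split; rewrite /J0 /=.
  - by exists 0; rewrite mul0r.
  - by move=> a x y [b ->] [c ->]; exists (a * b + c); rewrite mulrDl mulrA.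
  - by exists 1; rewrite mul1r.
  - by move=> [a /esym/eqP]; apply/negP/p_not_unit.
case: PJ => [J_0|[Ji Jp J1]].
  case: (Jmax J0) => //; rewrite J_0 properEneq; split; last exact: sub0set.
  apply/eqP => /(congr1 (fun X : set O => X 0)) /= e.
  by have : J0 0 by [exists 0; rewrite mul0r]; rewrite -e.
exists J; split=> // J' J'i JJ' J'1; apply: contrapT => nJ'J.
apply: (Jmax J'); first by split.
by right; split=> //; apply: JJ'.
Qed.

(** A maximal ideal containing p is prime, and an integer in it that is prime to p would generate 1
    together with p. *)
Lemma lying_over : exists I : prime_idealr O, lies_above I p.
Proof.
have [J [[J0 Ji] Jp J1 Jmax]] := maximal_ideal_above.
pose I : pred O := fun x => `[< J x >].
have JM a x : J x -> J (a * x) by move=> Jx; rewrite -[_ * _]addr0; apply: Ji.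
have Ic : idealr_closed I.
  split; first exact/asboolP; first exact/asboolP.
  by move=> a x y /asboolP Jx /asboolP Jy; apply/asboolP; apply: Ji.
have Ip : prime_idealr_closed I.
  move=> u v /asboolP Juv; apply/orP.
  have [Ju|nJu] := pselect (J u); [by left; apply/asboolP | right; apply/asboolP].
  (* The ideal generated by J and u. If [1 = a u + b] with b in J, then [v = a (u v) + b v] is in J;
     otherwise maximality puts u in J. *)
  pose J' : set O := [set x | exists a b, J b /\ x = a * u + b].
  have [J'1|nJ'1] := pselect (J' 1).
    case: J'1 => a [b [Jb e]]; rewrite -[v]mul1r e mulrDl.
    rewrite -mulrA; apply: Ji => //; rewrite mulrC; exact: JM.
  case: nJu; apply: (Jmax J') nJ'1 _ _.
  - split; first by exists 0, 0; rewrite mul0r addr0.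
    move=> c x y [a [b [Jb ->]]] [a' [b' [Jb' ->]]].
    exists (c * a + a'), (c * b + b'); split; first exact: Ji.
    by rewrite mulrDr mulrA mulrDl addrACA.
  - by move=> x Jx; exists 0, x; rewrite mul0r add0r.
  - by exists 1, 0; rewrite mul1r addr0.
pose mI := isIdealr.Build O I Ic.
pose mP := isPrimeIdealrClosed.Build O I Ip.
pose PI : prime_idealr O := HB.pack I mI mP.
exists PI => m; have -> : (m%:~R \in PI) = `[< J m%:~R >] by [].
apply/asboolP/idP => [Jm|/dvdzP[q ->]]; last by rewrite intrM; apply: JM.
apply: contrapT => /negP pm; apply: J1.
have /coprimezP[[u w] /= uw] : coprimez p%:Z m.
  by rewrite coprimezE /= prime_coprime // -dvdzE.
have -> : 1 = w%:~R * m%:~R + (u%:~R * p%:R + 0) :> O.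
  by rewrite addr0 addrC -[p%:R]/((p%:Z)%:~R) -!intrM -intrD uw.
by apply: (Ji _ _ _ Jm); apply: (Ji _ _ _ Jp).
Qed.

End LyingOver.

Lemma char_poly_trmx (R : comNzRingType) n (M : 'M[R]_n) :
  char_poly M^T = char_poly M.
Proof.
rewrite /char_poly -det_tr; congr (\det _).
by apply/matrixP => i j; rewrite !mxE eq_sym.
Qed.

(** * Eigenvalues in K and the identification of X with the divisible part *)

Section XspaceDvs.
Variables (K : fieldExtType rat) (iota : {rmorphism K -> algC}).
Variables (n : nat) (A : 'M[int]_n.+1).
Local Notation O := (ring_of_integers K).
Local Notation AK := (map_mx intr A : 'M[K]_n.+1).

(** The factorization exists over [algC]; its roots come from K by hypothesis and are integral as
    roots of the monic [char_poly A]. Injectivity of [iota] on polynomials brings the factorization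
    back to K. *)
Lemma char_poly_split :
  (forall a : algC, eigenvalue (map_mx intr A) a -> exists x, iota x = a) ->
  exists s : seq O, char_poly AK = roots_poly (map (@int_val K) s).
Proof.
move=> eigK.
have [r rE] := closed_field_poly_normal (char_poly (map_mx intr A : 'M[algC]_n.+1)).
have {}rE : map_poly iota (char_poly AK) = roots_poly r.
  rewrite map_char_poly -map_mx_comp.
  have -> : map_mx (iota \o intr) A = map_mx intr A.
    by apply/matrixP => i j; rewrite !mxE /= rmorph_int.
  by rewrite rE (monicP (char_poly_monic _)) scale1r.
have rK z : z \in r -> exists x : O, iota (int_val x) = z.
  move=> zr; have [x xz] : exists x, iota x = z.
    apply: eigK; rewrite eigenvalue_root_char.
    rewrite -root_prod_XsubC in zr; move: zr.
    rewrite -[\prod_(_ <- _) _]/(roots_poly r) -rE.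
    rewrite map_char_poly -map_mx_comp; congr (root (char_poly _) z).
    by apply/matrixP => i j; rewrite !mxE /= rmorph_int.
  have xr : root (map_poly intr (char_poly A)) x.
    rewrite -(fmorph_root iota) xz.
    have -> : map_poly intr (char_poly A) = char_poly AK by rewrite map_char_poly.
    by rewrite rE root_prod_XsubC.
  have xI : x \in @alg_integer K.
    by apply/asboolP; exists (char_poly A); [apply: char_poly_monic | exact: xr].
  by exists (RingOfIntegers xI).
have [s sE] : exists s : seq O, r = map (fun x => iota (int_val x)) s.
  elim: r rK {rE} => [|z r IH] rK; first by exists [::].
  have [x xz] := rK z (mem_head _ _).
  have [y yr|s ->] := IH; first by apply: rK; rewrite inE yr orbT.
  by exists (x :: s); rewrite /= xz.
exists s; apply: (map_poly_inj iota); rewrite rE sE /roots_poly !big_map rmorph_prod.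
by apply: eq_bigr => x _; rewrite rmorphB /= map_polyX map_polyC.
Qed.

Variable I : prime_idealr (ring_of_integers K).
Variable p : nat.
Hypotheses (p_pr : prime p) (Ip : lies_above I p).

Section Splitting.
Variable s : seq O.
Hypothesis sE : char_poly AK = roots_poly (map (@int_val K) s).
Let s1 := [seq int_val a | a <- s & a \in I].
Let s2 := [seq int_val a | a <- s & a \notin I].

Lemma char_poly_small_large : char_poly AK = roots_poly s1 * roots_poly s2.
Proof.
by rewrite sE /roots_poly !big_map !big_filter (bigID (mem I)).
Qed.

Lemma roots_small a : a \in s1 -> small (loc I) p%:R a.
Proof.
move=> /mapP[b]; rewrite mem_filter => /andP[bI _] ->.
exact: ideal_small.
Qed.

Lemma roots_large a : a \in s2 -> large (loc I) a.
Proof.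
move=> /mapP[b]; rewrite mem_filter => /andP[bI _] ->.
exact: not_ideal_large.
Qed.

(** A generalized eigenvector for a in I is killed by a power of [X - a], so [dvs_small] applies
    with copies of a as roots. Conversely [dvs] is the kernel of the small factor, which
    [roots_poly_kernel] splits into generalized eigenspaces. *)
Lemma Xspace_dvs v : Xspace A I v <-> dvs (loc I) AK v.
Proof.
have AO : AK \is a mxOver (loc I) by apply: map_int_over.
have piS := loc_p p I; have pi0 := p_neq0 K p_pr.
have piK := loc_clear p_pr Ip; have piVS := loc_pV p_pr Ip.
split.
  move: v; apply: lin_span_min => [|u v uD vD|c x _].
  - exact: dvs0.
  - exact: dvsD.
  move=> [a [aI _ [_ [m xm]]]]; apply: dvsZ.
  apply: (@dvs_small _ _ _ piS pi0 piK _ _ AO (nseq m (int_val a))).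
    by move=> b /nseqP[-> _]; apply: ideal_small.
  rewrite /roots_poly big_nseq iter_mulr_1 rmorphXn rmorphB /=.
  by rewrite horner_mx_X horner_mx_C.
move/(dvs_kernel piS pi0 piVS piK AO roots_small roots_large char_poly_small_large).
apply: roots_poly_kernel v => [|u w|a m v]; first exact: lin_span0.
  exact: lin_spanD.
move=> as1 av; have [->|v0] := eqVneq v 0; first exact: lin_span0.
rewrite -[v]scale1r; apply: lin_span_gen => //.
have /mapP[b] := as1; rewrite mem_filter => /andP[bI _] aE.
exists b; rewrite -aE; split => //; last by split=> //; exists m.
rewrite eigenvalue_root_char char_poly_trmx char_poly_small_large rootM.
by rewrite root_prod_XsubC as1.
Qed.

Lemma loc_bounded_mod_dvs : exists r, forall v, lat (loc I) AK v ->
  exists x y, [/\ dvs (loc I) AK x, y \is a mxOver (loc I) & p%:R ^+ r *: v = x + y].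
Proof.
have AO : AK \is a mxOver (loc I) by apply: map_int_over.
exact: (lat_bounded_mod_dvs (loc_p p I) (p_neq0 K p_pr) (loc_pV p_pr Ip)
  (loc_clear p_pr Ip) AO roots_small roots_large char_poly_small_large).
Qed.

End Splitting.
End XspaceDvs.

(** * The p-adic module generated by G_A *)

Section PadicNumbers.
Variable p : prime_number.
Local Notation Zp := (padic_int p).
Local Notation Qp := (padic p).

Lemma zp_natE m : (m%:R : Zp) = zp_int p m%:Z.
Proof.
elim: m => // m IH; rewrite mulrS IH; apply: zp_ext => k /=.
by rewrite modzDm -natz -mulrS natz.
Qed.

Lemma zp_intE m : (m%:~R : Zp) = zp_int p m.
Proof.
case: m => m; first exact: zp_natE.
rewrite NegzE mulrNz -[_%:~R]/(m.+1%:R) zp_natE.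
by apply: zp_ext => k /=; rewrite modzNm.
Qed.

Lemma zp_intr_eq0 m : (m%:~R : Zp) = 0 -> m = 0.
Proof.
(* [p^|m|] exceeds [|m|], so this single residue detects whether m is zero. *)
rewrite zp_intE => /(congr1 (fun x : Zp => x `|m|%N)) /=; rewrite mod0z => /dvdz_mod0P.
rewrite dvdzE /=; have [//|m0] := eqVneq m 0.
by rewrite gtnNdvd ?absz_gt0 // (leq_trans (ltn_expl _ (prime_gt1 (valP p)))) //.
Qed.

Lemma padic_intr_eq0 m : (m%:~R : Qp) = 0 -> m = 0.
Proof.
rewrite -(rmorph_int (@tofrac Zp)) => /eqP; rewrite tofrac_eq0 => /eqP.
exact: zp_intr_eq0.
Qed.

Lemma padic_int_neq0 m : m != 0 -> (m%:~R : Qp) != 0.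
Proof. by apply: contra_neq; apply: padic_intr_eq0. Qed.

(* [ratr] is a ring morphism only into [numFieldType]s in the library, so the
   instance for the p-adic numbers is declared on this alias. *)
Definition qp : rat -> Qp := ratr.

Lemma qpM_den x : qp x * (denq x)%:~R = (numq x)%:~R.
Proof. by rewrite /qp /ratr divfK // padic_int_neq0 // denq_neq0. Qed.

(** Allows any fraction [e / d] for x instead of the reduced one in the definition of [ratr]; sums
    and products can then use the product of the denominators. *)
Lemma qp_fracE x y (d e : int) : d != 0 ->
  x * d%:~R = e%:~R -> y * d%:~R = e%:~R -> qp x = y.
Proof.
move=> d0 xd yd; have dn0 : denq x * d != 0 by rewrite mulf_neq0 ?denq_neq0.
apply: (mulIf (padic_int_neq0 dn0)); rewrite rmorphM /= mulrA qpM_den.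
rewrite mulrCA yd -!rmorphM; congr _%:~R; apply: (intr_inj (R := rat)).
by rewrite !rmorphM /= -xd numqE mulrCA mulrA.
Qed.

Lemma qp_zmod : zmod_morphism qp.
Proof.
move=> x y; apply: (@qp_fracE _ _ (denq x * denq y) (numq x * denq y - numq y * denq x)).
- by rewrite mulf_neq0 ?denq_neq0.
- by rewrite rmorphB !rmorphM /= !numqE; ring.
- by rewrite rmorphB !rmorphM /= -!qpM_den; ring.
Qed.

Lemma qp_monoid : monoid_morphism qp.
Proof.
split=> [|x y]; first by apply: (@qp_fracE _ _ 1 1); rewrite ?mulr1.
apply: (@qp_fracE _ _ (denq x * denq y) (numq x * numq y)).
- by rewrite mulf_neq0 ?denq_neq0.
- by rewrite !rmorphM /= !numqE mulrACA.
- by rewrite !rmorphM /= -!qpM_den mulrACA.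
Qed.

HB.instance Definition _ := GRing.isZmodMorphism.Build rat Qp qp qp_zmod.
HB.instance Definition _ := GRing.isMonoidMorphism.Build rat Qp qp qp_monoid.

Definition padicZ : pred Qp := fun x => `[< padic_int_in p x >].

Lemma padicZP x : reflect (exists z : Zp, x = tofrac z) (x \in padicZ).
Proof. by apply: (iffP (asboolP _)) => [[z _ <-]|[z ->]]; exists z. Qed.

Lemma padicZ_subring : subring_closed padicZ.
Proof.
split; first by apply/padicZP; exists 1; rewrite rmorph1.
  move=> x y /padicZP[z ->] /padicZP[w ->]; apply/padicZP.
  by exists (z - w); rewrite rmorphB.
move=> x y /padicZP[z ->] /padicZP[w ->]; apply/padicZP.
by exists (z * w); rewrite rmorphM.
Qed.

HB.instance Definition _ := GRing.isSubringClosed.Build Qp padicZ padicZ_subring.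

(* The ring Z_(p). *)
Definition zloc : pred rat :=
  fun q => `[< exists s : nat, ~~ (val p %| s)%N /\ s%:R * q \is a Num.int >].

Lemma zloc_subring : subring_closed zloc.
Proof.
have pp := valP p.
split.
- by apply/asboolP; exists 1%N; rewrite gtnNdvd ?prime_gt1 // mulr1 rpred1.
- move=> x y /asboolP[s [ps sx]] /asboolP[r [pr ry]]; apply/asboolP.
  exists (s * r)%N; rewrite Euclid_dvdM // negb_or ps pr natrM; split=> //.
  have -> : s%:R * r%:R * (x - y) = r%:R * (s%:R * x) - s%:R * (r%:R * y) by ring.
  by rewrite rpredB // rpredM ?rpred_nat.
- move=> x y /asboolP[s [ps sx]] /asboolP[r [pr ry]]; apply/asboolP.
  exists (s * r)%N; rewrite Euclid_dvdM // negb_or ps pr natrM; split=> //.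
  by rewrite mulrACA rpredM.
Qed.

HB.instance Definition _ := GRing.isSubringClosed.Build rat zloc zloc_subring.

Lemma zlocP q : reflect (exists2 s : nat, ~~ (val p %| s)%N & s%:R * q \is a Num.int)
  (q \in zloc).
Proof. by apply: (iffP (asboolP _)) => [[s []]|[s]]; exists s. Qed.

Lemma ratp_neq0 : ((val p)%:R : rat) != 0.
Proof. by rewrite pnatr_eq0 -lt0n prime_gt0 // (valP p). Qed.

Lemma zloc_pV : ((val p)%:R : rat)^-1 \notin zloc.
Proof.
apply/negP => /zlocP[s ps /intrP[m sm]]; case/negP: ps.
have e : s%:Z = m * (val p)%:Z.
  by apply: (intr_inj (R := rat)); rewrite intrM -sm -mulrA mulVf ?mulr1 // ratp_neq0.
by rewrite -[s]/(`|s%:Z|)%N e abszM dvdn_mull.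
Qed.

Lemma zloc_denq q : ~~ (val p %| `|denq q|)%N -> q \in zloc.
Proof.
move=> pq; apply/asboolP; exists `|denq q|%N; split=> //.
rewrite -[_%:R]/((`|denq q|%N%:Z)%:~R) (gez0_abs (ltW (denq_gt0 q))) mulrC -numqE.
exact: rpred_int.
Qed.

(** If p divided the denominator, the residue modulo p of [z * denq q = numq q] would make p divide
    the numerator as well. *)
Lemma qp_zpin q : qp q \in padicZ -> q \in zloc.
Proof.
move=> /padicZP[z qz]; apply: zloc_denq; apply/negP => pd.
have : z * (denq q)%:~R = (numq q)%:~R :> Zp.
  by apply/eqP; rewrite -tofrac_eq tofracM -qz !(rmorph_int (@tofrac Zp)) qpM_den.
move=> /(congr1 (fun x : Zp => x 1%N)); rewrite !zp_intE /= expn1 => e.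
have : ((val p)%:Z %| numq q)%Z.
  apply/dvdz_mod0P; rewrite -e -modzMmr modz_mod modzMmr; apply/dvdz_mod0P.
  by rewrite dvdz_mull // dvdzE.
rewrite dvdzE /= => pn; have := coprime_num_den q; rewrite /coprime => /eqP g1.
have : (val p %| gcdn `|numq q| `|denq q|)%N by rewrite dvdn_gcd pn pd.
by rewrite g1 gtnNdvd // prime_gt1 // (valP p).
Qed.

Lemma padicZ_pV : qp (val p)%:R^-1 \notin padicZ.
Proof. by apply: contra zloc_pV; apply: qp_zpin. Qed.

Lemma zp_natX m k : ((val p)%:R ^+ m : Zp) k = ((val p ^ m)%N%:Z %% (val p ^ k)%N%:Z)%Z.
Proof. by rewrite -natrX zp_natE. Qed.

Lemma zp_res_split (z : Zp) m : exists y : Zp, z = (z m)%:~R + (val p)%:R ^+ m * y.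
Proof.
set P := fun k => (val p ^ k)%N%:Z.
have P0 k : P k != 0.
  by rewrite /P; case: (p) => q qp_ /=; rewrite -lt0n expn_gt0 prime_gt0.
(* The residues of y: the division is exact because [z (k + m)] reduces to [z m] modulo [p^m]. *)
pose f k := ((z (k + m)%N - z m) %/ P m)%Z.
have fE k : z (k + m)%N = z m + P m * f k.
  rewrite mulrC divzK ?subrKC //.
  by rewrite /dvdz; apply/dvdz_mod0P; rewrite -modzDml zp_res_le ?leq_addl // subrr mod0z.
have fc : coherent p f.
  move=> k; apply/eqP; rewrite eqz_mod_dvd -(dvdz_mul2l (P0 m)).
  have -> : P m * (f k.+1 - f k) = z (k + m).+1%N - z (k + m)%N.
    by rewrite -addSn !fE; ring.
  rewrite -[_ * _]/(((val p ^ m) * (val p ^ k))%N%:Z) -expnD addnC.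
  by rewrite -eqz_mod_dvd zp_resP zp_mod.
exists (zp_of fc); apply: zp_ext => k; rewrite zp_intE /=.
rewrite zp_natX /= modzMm modzDm -fE.
by rewrite zp_res_le // leq_addr.
Qed.

End PadicNumbers.

Lemma mulmx_col_sum (R : comNzRingType) m n (M : 'M[R]_(m, n)) (w : 'cV[R]_n) :
  M *m w = \sum_j w j 0 *: col j M.
Proof.
by apply/colP => i; rewrite mxE summxE; apply: eq_bigr => j _; rewrite !mxE mulrC.
Qed.

Lemma map_mx_exp (R S : nzRingType) (f : {rmorphism R -> S}) n (M : 'M[R]_n.+1) k :
  map_mx f (M ^+ k) = map_mx f M ^+ k.
Proof. exact: (rmorphXn (map_mx f)). Qed.

Lemma map_mx_intr (R S : nzRingType) (f : {rmorphism R -> S}) m n (M : 'M[int]_(m, n)) :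
  map_mx f (map_mx intr M) = map_mx intr M.
Proof. by apply/matrixP => i j; rewrite !mxE rmorph_int. Qed.

(** * G_A as a lattice, and its extensions of scalars *)

Section Ggroup.
Variables (n : nat) (A : 'M[int]_n.+1).
Hypothesis detA : \det A != 0.

Lemma map_intr_unit (F : fieldType) : (forall m : int, m%:~R = 0 :> F -> m = 0) ->
  (map_mx intr A : 'M[F]_n.+1) \in unitmx.
Proof.
move=> F0; rewrite unitmxE unitfE det_map_mx.
by apply: contra_neq detA; apply: F0.
Qed.

Lemma ratM_unit : ratM A \in unitmx.
Proof.
by apply: map_intr_unit => m /eqP; rewrite intr_eq0 => /eqP.
Qed.

Lemma mxOver_intP m k (M : 'M[rat]_(m, k)) :
  reflect (exists N : 'M[int]_(m, k), M = map_mx intr N) (M \is a mxOver Num.int).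
Proof.
apply: (iffP idP) => [/mxOverP MZ|[N ->]]; last exact: map_int_over.
have /choice[N NE] : forall ij, exists z : int, M ij.1 ij.2 = z%:~R.
  by move=> ij; apply/intrP.
by exists (\matrix_(i, j) N (i, j)); apply/matrixP => i j; rewrite !mxE (NE (i, j)).
Qed.

Lemma Ggroup_lat v : Ggroup A v <-> lat Num.int (ratM A) v.
Proof.
have Au : ratM A \is a GRing.unit := ratM_unit.
have AZ : ratM A \is a mxOver Num.int by apply: map_int_over.
split.
  move=> [[k|k] [x ->]].
    exists k; rewrite -invr_expz -exprnP mulmxA -[_ *m _^-1]/(_ * _^-1).
    by rewrite mulrV ?unitrX // mul1mx map_int_over.
  (* A negative exponent k gives a positive power of A, hence an integral vector. *)
  apply: lat_over; rewrite NegzE opprK -exprnP.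
  by apply: mxOverM; [apply: mxOverX | apply: map_int_over].
move=> [k /mxOver_intP[x xE]]; exists k, x.
rewrite -xE -invr_expz -exprnP mulmxA -[_^-1 *m _]/(_^-1 * _).
by rewrite mulVr ?unitrX // mul1mx.
Qed.

(** With [w = A^k v] over S, expand [v = A^-k w] along the columns of [A^-k]. These columns are in
    G_A by [Ggroup_column], so claims about [lat] over S reduce to claims about G_A. *)
Lemma lat_columns (F : fieldType) (S : subringClosed F) (iota : {rmorphism rat -> F}) v :
  lat S (map_mx intr A) v -> exists k (w : 'cV[F]_n.+1), w \is a mxOver S /\
    v = \sum_j w j 0 *: map_mx iota ((ratM A)^-1 ^+ k *m delta_mx j 0).
Proof.
move=> [k kS]; exists k, (map_mx intr A ^+ k *m v); split=> //.
have Au : ratM A \is a GRing.unit := ratM_unit.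
have AE : map_mx intr A = map_mx iota (ratM A) :> 'M[F]_n.+1.
  by rewrite map_mx_intr.
transitivity (map_mx iota ((ratM A)^-1 ^+ k) *m (map_mx intr A ^+ k *m v)).
  rewrite AE -map_mx_exp mulmxA -map_mxM -[_ *m ratM A ^+ k]/(_ * ratM A ^+ k).
  by rewrite exprVn mulVr ?unitrX // map_mx1 mul1mx.
rewrite [LHS]mulmx_col_sum; apply: eq_bigr => j _; congr (_ *: _).
by rewrite colE map_mxM map_delta_mx.
Qed.

Lemma Ggroup_column k j : Ggroup A ((ratM A)^-1 ^+ k *m delta_mx j 0).
Proof.
exists k, (delta_mx j 0).
by rewrite -invr_expz -exprnP exprVn map_delta_mx.
Qed.

Lemma Ggroup_lat_map (F : fieldType) (S : subringClosed F)
    (iota : {rmorphism rat -> F}) v :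
  Ggroup A v -> lat S (map_mx intr A) (map_mx iota v).
Proof.
move=> /Ggroup_lat[l /mxOver_intP[N NE]]; exists l.
have -> : map_mx intr A = map_mx iota (ratM A) :> 'M[F]_n.+1 by rewrite map_mx_intr.
by rewrite -map_mx_exp -map_mxM NE map_mx_intr map_int_over.
Qed.

End Ggroup.

Lemma lat_image n (A B : 'M[int]_n.+1) (T : 'M[rat]_n.+1) (F : fieldType)
    (S : subringClosed F) (iota : {rmorphism rat -> F}) :
  \det A != 0 -> \det B != 0 ->
  (forall v, Ggroup A v -> Ggroup B (T *m v)) ->
  forall v, lat S (map_mx intr A) v -> lat S (map_mx intr B) (map_mx iota T *m v).
Proof.
move=> dA dB TAB v /(lat_columns dA iota)[k [w [wS ->]]].
have BS : map_mx intr B \is a mxOver S by apply: map_int_over.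
rewrite mulmx_sumr; apply: lat_sum => // j _.
rewrite -scalemxAr; apply: latZ; first exact: (mxOverP wS).
by rewrite -map_mxM; apply: Ggroup_lat_map => //; apply/TAB/Ggroup_column.
Qed.

Lemma Gbar_lat n (A : 'M[int]_n.+1) p : \det A != 0 ->
  forall v, Gbar A p v <-> lat (@padicZ p) (map_mx intr A) v.
Proof.
move=> dA v.
have AS : map_mx intr A \is a mxOver (@padicZ p) by apply: map_int_over.
split.
  move: v; apply: lin_span_min => [|u w|c x cS [y yG <-]]; first exact: lat0.
    exact: latD.
  apply: latZ; first exact/asboolP.
  exact: (Ggroup_lat_map dA _ (qp p)).
move=> /(lat_columns dA (qp p))[k [w [wS ->]]].
apply: lin_span_sum => j _; apply: lin_span_gen.
  by have /asboolP := mxOverP wS j 0.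
by exists ((ratM A)^-1 ^+ k *m delta_mx j 0); first exact: Ggroup_column.
Qed.

(** * Coordinates adapted to a characteristic *)

Section Characteristic.
Variables (n : nat) (A : 'M[int]_n.+1) (p : prime_number) (t : nat).
Variable alpha : 'M[padic_int p]_n.+1.
Local Notation Qp := (padic p).

(* The coordinates of v on e_k, k >= t, in the basis formed by the x_i, i < t,
   and the e_k; see [char_decomposition]. *)
Definition ell (v : 'cV[Qp]_n.+1) k : Qp :=
  v k 0 - \sum_(i < n.+1 | (i < t)%N) v i 0 * tofrac (alpha i k).

Lemma ellD u v k : ell (u + v) k = ell u k + ell v k.
Proof.
rewrite /ell mxE addrACA -opprD -big_split /=; congr (_ - _).
by apply: eq_bigr => i _; rewrite mxE mulrDl.
Qed.

Lemma ellZ c v k : ell (c *: v) k = c * ell v k.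
Proof.
rewrite /ell mxE mulrBr mulr_sumr; congr (_ - _).
by apply: eq_bigr => i _; rewrite mxE mulrA.
Qed.

Lemma ell0 k : ell 0 k = 0.
Proof. by rewrite -(scale0r 0) ellZ mul0r. Qed.

Lemma ell_sum I r (P : pred I) (f : I -> 'cV[Qp]_n.+1) k :
  ell (\sum_(i <- r | P i) f i) k = \sum_(i <- r | P i) ell (f i) k.
Proof.
by elim/big_rec2: _ => [|i x y _ <-]; [apply: ell0 | rewrite ellD].
Qed.

Lemma char_vecE (i j : 'I_n.+1) :
  char_vec t alpha i j 0 = (j == i)%:R + (if (t <= j)%N then tofrac (alpha i j) else 0).
Proof.
rewrite mxE [delta_mx _ _ _ _]mxE andbT summxE; congr (_ + _).
rewrite [LHS](eq_bigr (fun k : 'I_n.+1 => if k == j then tofrac (alpha i j) else 0)).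
  by rewrite -big_mkcondr /=; case: ifP => tj;
    [rewrite (big_pred1 j) // => k; rewrite /= andbC; case: eqP => // ->
    | rewrite big_pred0 // => k; case: eqP => [->|]; rewrite ?tj ?andbF].
move=> k _; rewrite !mxE andbT eq_sym; case: eqP => [->|_]; by rewrite ?mulr1 ?mulr0.
Qed.

Lemma ell_char_vec (i k : 'I_n.+1) : (i < t)%N -> (t <= k)%N ->
  ell (char_vec t alpha i) k = 0.
Proof.
move=> it tk; rewrite /ell (bigD1 i) //= big1 => [|j /andP[jt ji]]; last first.
  by rewrite char_vecE (negPf ji) leqNgt jt add0r mul0r.
rewrite !char_vecE eqxx tk leqNgt it !addr0 mul1r.
have -> : (k == i) = false by apply: contraTF tk => /eqP->; rewrite -ltnNge.
by rewrite add0r subrr.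
Qed.

Lemma ell_delta (j k : 'I_n.+1) : (t <= j)%N -> ell (delta_mx j 0) k = (k == j)%:R.
Proof.
move=> tj; rewrite /ell mxE andbT big1 ?subr0 // => i it.
rewrite mxE andbT; have -> : (i == j) = false.
  by apply: contraTF tj => /eqP <-; rewrite -ltnNge.
by rewrite mul0r.
Qed.

Lemma char_decomposition (v : 'cV[Qp]_n.+1) : v =
  \sum_(i < n.+1 | (i < t)%N) v i 0 *: char_vec t alpha i
  + \sum_(k < n.+1 | (t <= k)%N) ell v k *: delta_mx k 0.
Proof.
apply/colP => j; rewrite mxE !summxE.
rewrite (eq_bigr (fun i => v i 0 * char_vec t alpha i j 0)); last first.
  by move=> i _; rewrite mxE.
rewrite [X in _ = _ + X](eq_bigr (fun k => ell v k * (j == k)%:R)); last first.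
  by move=> k _; rewrite !mxE andbT.
have [tj|jt] := leqP t j.
  rewrite [X in _ = _ + X](bigD1 j) //= eqxx mulr1.
  rewrite [X in _ + (_ + X)]big1 ?addr0; last first.
    by move=> k /andP[_ kj]; rewrite eq_sym (negPf kj) mulr0.
  rewrite /ell addrC -[LHS](subrK (\sum_(i < n.+1 | (i < t)%N) v i 0 * tofrac (alpha i j))).
  congr (_ + _); apply: eq_bigr => i it; rewrite char_vecE tj.
  have -> : (j == i) = false by apply: contraTF tj => /eqP->; rewrite -ltnNge.
  by rewrite add0r.
rewrite [X in _ = _ + X]big1 ?addr0; last first.
  move=> k tk; have -> : (j == k) = false.
    by apply: contraTF tk => /eqP <-; rewrite -ltnNge.
  by rewrite mulr0.
rewrite (bigD1 j) //= big1 ?addr0 => [|i /andP[_ ij]]; rewrite char_vecE leqNgt jt addr0.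
  by rewrite eqxx mulr1.
by rewrite eq_sym (negPf ij) mulr0.
Qed.

Hypothesis dA : \det A != 0.
Hypothesis charA : is_direct_sum (Gbar A p)
      (lin_span setT
        [set char_vec t alpha i | i in [set i : 'I_n.+1 | (i < t)%N]])
      (lin_span (padic_int_in p)
        [set (delta_mx j 0 : 'cV_n.+1) | j in [set j : 'I_n.+1 | (t <= j)%N]]).

(** The coordinates [ell] vanish on the divisible summand and read off the coefficients in the free
    one; [char_decomposition] gives the converse. *)
Lemma lat_ellP v : lat (@padicZ p) (map_mx intr A) v <->
  forall k : 'I_n.+1, (t <= k)%N -> ell v k \in @padicZ p.
Proof.
have [charG _] := charA; split.
  move=> /(Gbar_lat dA); rewrite charG => -[u1 [u2 [u1D u2S ->]]] k tk.
  rewrite ellD; have -> : ell u1 k = 0.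
    move: u1 u1D; apply: lin_span_min => [|u w uk wk|c x _ [i it <-]]; first exact: ell0.
      by rewrite /= ellD uk wk addr0.
    by rewrite /= ellZ ell_char_vec ?mulr0.
  rewrite add0r; move: u2 u2S.
  apply: lin_span_min => [|u w uk wk|c x cS [j tj <-]]; first by rewrite /= ell0 rpred0.
    by rewrite /= ellD rpredD.
  by rewrite /= ellZ ell_delta // rpredM ?rpred_nat //; apply/asboolP.
move=> vS; apply/(Gbar_lat dA); rewrite charG [v]char_decomposition.
eexists; eexists; split; last reflexivity.
  by apply: lin_span_sum => i it; apply: lin_span_gen => //; exists i.
apply: lin_span_sum => k tk; apply: lin_span_gen; last by exists k.
by have /asboolP := vS k tk.
Qed.

Lemma dvs_ellP v : dvs (@padicZ p) (map_mx intr A) v <->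
  forall k : 'I_n.+1, (t <= k)%N -> ell v k = 0.
Proof.
split=> [vD k tk|v0 c]; last first.
  by apply/lat_ellP => k tk; rewrite ellZ v0 // mulr0 rpred0.
apply/eqP/negPn/negP => v0.
(* The scalar turns the coordinate into [p^-1], which is not a p-adic integer. *)
have /lat_ellP/(_ k tk) := vD ((qp p (val p)%:R^-1) / ell v k).
by rewrite ellZ divfK //; apply/negP/padicZ_pV.
Qed.

Lemma lat_zloc (v : 'cV[rat]_n.+1) :
  lat (@padicZ p) (map_mx intr A) (map_mx (@qp p) v) -> lat (@zloc p) (ratM A) v.
Proof.
move=> [k kS]; exists k; apply/mxOverP => i j; apply: (@qp_zpin p).
have := mxOverP kS i j.
have -> : map_mx intr A ^+ k *m map_mx (@qp p) v = map_mx (@qp p) (ratM A ^+ k *m v).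
  by rewrite map_mxM map_mx_exp map_mx_intr.
by rewrite mxE.
Qed.

(** Replace each p-adic coordinate [ell] of v by its residue modulo [p^m]. The error has coordinates
    divisible by [p^m], so its quotient w by [p^m] is again in the lattice; being rational, w is so
    over Z_(p). *)
Lemma lat_approx (v : 'cV[rat]_n.+1) m :
  lat (@padicZ p) (map_mx intr A) (map_mx (@qp p) v) ->
  exists (a : 'I_n.+1 -> int) w, lat (@zloc p) (ratM A) w /\
    v = \sum_(j < n.+1 | (t <= j)%N) (a j)%:~R *: delta_mx j 0 + (val p)%:R ^+ m *: w.
Proof.
move=> /lat_ellP vS.
have /choice[z zE] (k : 'I_n.+1) : exists z : padic_int p,
    (t <= k)%N -> ell (map_mx (@qp p) v) k = tofrac z.
  by have [/vS/padicZP[z ->]|_] := leqP t k; [exists z | exists 0].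
have p0 := ratp_neq0 p.
pose u : 'cV[rat]_n.+1 := \sum_(j < n.+1 | (t <= j)%N) (z j m)%:~R *: delta_mx j 0.
exists (fun j => z j m), ((val p)%:R ^- m *: (v - u)); split; last first.
  by rewrite scalerA mulfV ?expf_neq0 // scale1r addrC subrK.
apply: lat_zloc; apply/lat_ellP => k tk.
have [y yE] := zp_res_split (z k) m.
rewrite map_mxZ map_mxB ellZ -[_ - _]/(_ + - _) ellD -scaleN1r ellZ mulN1r zE //.
have -> : ell (map_mx (@qp p) u) k = (z k m)%:~R.
  rewrite map_mx_sum ell_sum (bigD1 k) //= big1 ?addr0.
    by rewrite map_mxZ ellZ map_delta_mx ell_delta // eqxx mulr1 rmorph_int.
  move=> j /andP[tj jk]; rewrite map_mxZ ellZ map_delta_mx ell_delta //.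
  by rewrite eq_sym (negPf jk) mulr0.
rewrite {1}yE rmorphD rmorphM !rmorphXn /=.
rewrite (rmorph_int (@tofrac _)) (rmorph_nat (@tofrac _)).
rewrite addrAC subrr add0r fmorphV rmorphXn rmorph_nat mulKf.
  by apply/padicZP; exists y.
rewrite expf_neq0 // -[(val p)%:R]/((val p)%:Z%:~R) padic_int_neq0 //.
by rewrite eqz_nat -lt0n prime_gt0 // (valP p).
Qed.

End Characteristic.

(** * Local structure of G_A and the theorem *)

Section LocalRationals.
Variable p : prime_number.
Let pp : prime (val p) := valP p.
Local Notation zloc := (@zloc p).

Lemma zloc_clear q : exists m, (val p)%:R ^+ m * q \in zloc.
Proof.
have d0 : (0 < `|denq q|)%N by rewrite absz_gt0 denq_neq0.
have [u pu dE] := pfactor_coprime pp d0.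
move: (logn _ _) dE => e dE; exists e; apply/zlocP; exists u.
  by rewrite -prime_coprime.
rewrite mulrA -natrX -natrM -dE -[_%:R]/((`|denq q|%N%:Z)%:~R).
by rewrite (gez0_abs (ltW (denq_gt0 q))) mulrC -numqE rpred_int.
Qed.

(** For q nonzero some [p^r q^-1] is in Z_(p), and its product with [q / p^(r + 1)] is [p^-1]. *)
Lemma zloc_divisible_eq0 q : (forall k, q / (val p)%:R ^+ k \in zloc) -> q = 0.
Proof.
move=> qk; apply/eqP/negPn/negP => q0; have [r rS] := zloc_clear q^-1.
case/negP: (zloc_pV p); have := rpredM rS (qk r.+1).
by rewrite mulrA divfK // exprS invfM mulrC -mulrA mulVf ?mulr1 // expf_neq0 // ratp_neq0.
Qed.

Lemma zloc_inv_int (m : int) : ~~ ((val p)%:Z %| m)%Z -> (m%:~R : rat)^-1 \in zloc.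
Proof.
move=> pm; apply/zlocP; exists `|m|%N; first by rewrite dvdzE in pm.
have m0 : (m%:~R : rat) != 0 by apply: contraNneq pm => /eqP; rewrite intr_eq0 => /eqP ->.
rewrite -[_%:R]/((`|m|%N%:Z)%:~R) abszEsign rmorphM rmorph_sign /= -mulrA mulfV // mulr1.
by rewrite rpredX // rpredN1.
Qed.

Lemma zloc_div_p (m : int) : m%:~R / (val p)%:R \in zloc -> ((val p)%:Z %| m)%Z.
Proof.
move=> mp; apply: contraT => pm; case/negP: (zloc_pV p).
have m0 : (m%:~R : rat) != 0 by apply: contraNneq pm => /eqP; rewrite intr_eq0 => /eqP ->.
by have := rpredM (zloc_inv_int pm) mp; rewrite mulKf.
Qed.

End LocalRationals.

(** * From all primes back to the integers *)

Section LocalGlobal.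
Variables (n : nat) (B : 'M[int]_n.+1).
Hypothesis dB : \det B != 0.
Let BZ : ratM B \is a mxOver Num.int. Proof. exact: map_int_over. Qed.

Lemma lat_zloc_multiple (p : prime_number) v : lat (@zloc p) (ratM B) v ->
  exists2 s : nat, ~~ (val p %| s)%N & lat Num.int (ratM B) (s%:R *: v).
Proof.
move=> [k /mxOverP kS]; set w := _ *m v in kS.
have /choice[s sP] i : exists s : nat, ~~ (val p %| s)%N /\ s%:R * w i 0 \is a Num.int.
  by have /zlocP[s] := kS i 0; exists s.
exists (\prod_i s i)%N.
  elim/big_rec: _ => [|i x _ px]; first by rewrite gtnNdvd // prime_gt1 // (valP p).
  by rewrite Euclid_dvdM ?(valP p) // negb_or px andbT; have [] := sP i.
exists k; rewrite -scalemxAr -/w; apply/mxOverP => i j; rewrite mxE ord1.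
rewrite (bigD1 i) //= natrM mulrAC rpredM ?rpred_nat //.
by have [] := sP i.
Qed.

(** Descent on a positive s with [s v] in the lattice: for a prime p dividing s, some r prime to p
    also has [r v] in the lattice, and [gcdn s r] is a smaller multiplier by Bezout. *)
Lemma local_global v : (forall p, lat (@zloc p) (ratM B) v) -> Ggroup B v.
Proof.
move=> vL; apply/(Ggroup_lat dB).
suff gcd_step s : (0 < s)%N -> lat Num.int (ratM B) (s%:R *: v) -> lat Num.int (ratM B) v.
  (* Any prime supplies a first multiplier; 2 is taken. *)
  have [s s2] := lat_zloc_multiple (vL (exist _ 2%N isT)); apply: gcd_step.
  by rewrite lt0n; apply: contraNneq s2 => ->.
have [m] := ubnP s; elim: m s => // m IH s; rewrite ltnS => sm s0 sL.
have [s1|s1] := leqP s 1.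
  have e : s = 1%N by apply/eqP; rewrite eqn_leq s1 s0.
  by rewrite e scale1r in sL.
have pp := pdiv_prime s1; pose p : prime_number := exist _ (pdiv s) pp.
have [r pr rL] := lat_zloc_multiple (vL p).
have ps : (pdiv s %| s)%N := pdiv_dvd s.
have gs : (gcdn s r < s)%N.
  rewrite ltn_neqAle dvdn_leq ?dvdn_gcdl // andbT; apply: contraNneq pr => gE.
  by rewrite /= (dvdn_trans ps) // -gE dvdn_gcdr.
apply: (IH (gcdn s r)); [exact: leq_trans gs sm | by rewrite gcdn_gt0 s0 |].
have [a b e _] := egcdnP r s0.
have -> : (gcdn s r)%:R *: v = a%:R *: (s%:R *: v) - b%:R *: (r%:R *: v).
  by rewrite !scalerA -!natrM -scalerBl e natrD addrAC subrr add0r.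
have nZ x y : lat Num.int (ratM B) y -> lat Num.int (ratM B) (x%:R *: y).
  by move=> yL; apply: latZ; rewrite ?rpred_nat.
by apply: (latD BZ); [|apply: latN]; apply: nZ.
Qed.

End LocalGlobal.

(* ['X - M] divides ['X^k - M^k] = 'X^k; take determinants. *)
Lemma nilpotent_char_poly (F : fieldType) n (M : 'M[F]_n.+1) k :
  M ^+ k = 0 -> char_poly M = 'X^(n.+1).
Proof.
move=> Mk0; set N := map_mx polyC M.
have Nk0 : N ^+ k = 0 by rewrite -map_mx_exp Mk0 map_mx0.
have := subrXX_comm k (comm_scalar_mx 'X N).
rewrite Nk0 subr0 -rmorphXn /= => /(congr1 determinant).
rewrite det_scalar -[_ * _]/(_ *m _) det_mulmx.
rewrite -/(char_poly_mx M) -/(char_poly M) -exprM => e.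
have /dvdp_exp_XsubCP[j _] : char_poly M %| ('X - 0%:P) ^+ (k * n.+1).
  by rewrite subr0 e dvdp_mulr.
rewrite subr0 eqp_monic ?char_poly_monic ?monicXn // => /eqP jE.
by rewrite jE; have := size_char_poly M; rewrite jE size_polyXn => -[->].
Qed.

(** * The lattice at p: primes not dividing the determinant, and nilpotent reduction *)

Section LocalStructure.
Variables (n : nat) (A : 'M[int]_n.+1) (p : prime_number).
Let pp : prime (val p) := valP p.
Let AS : ratM A \is a mxOver (@zloc p). Proof. exact: map_int_over. Qed.

Lemma Fp_intr_eq0 (m : int) : (m%:~R == 0 :> 'F_(val p)) = ((val p)%:Z %| m)%Z.
Proof.
rewrite dvdzE (intEsign m) rmorphM rmorph_sign mulf_eq0 signr_eq0 /=.
by rewrite abszMsign (dvdn_pcharf (pchar_Fp pp)).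
Qed.

Lemma lat_prime_to_det v : ~ Pset A p -> lat (@zloc p) (ratM A) v ->
  v \is a mxOver (@zloc p).
Proof.
move=> /negP pA; have dE : \det (ratM A) = (\det A)%:~R by rewrite det_map_mx.
apply: lat_det_inv => //; rewrite dE; last exact: zloc_inv_int.
by rewrite intr_eq0; apply: contraNneq pA => ->.
Qed.

(** By Cayley-Hamilton modulo p, [A^(n+1) = p M] with M integral, so [A^((n+1) r) = p^r M^r] clears
    the denominators of v for large r. *)
Lemma lat_nilpotent v : char_poly_mod p A = 'X^(n.+1) -> lat (@zloc p) (ratM A) v.
Proof.
move=> hA; set Ap : 'M['F_(val p)]_n.+1 := map_mx intr A.
have Ap0 : Ap ^+ n.+1 = 0.
  have := Cayley_Hamilton Ap; rewrite -map_char_poly -/(char_poly_mod p A) hA.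
  by rewrite rmorphXn /= horner_mx_X.
have [M ME] : exists M : 'M[int]_n.+1, A ^+ n.+1 = (val p)%:Z *: M.
  exists (\matrix_(i, j) ((A ^+ n.+1) i j %/ (val p)%:Z)%Z); apply/matrixP => i j.
  rewrite !mxE mulrC divzK // -Fp_intr_eq0; apply/eqP.
  by move/matrixP/(_ i j): Ap0; rewrite -map_mx_exp !mxE.
have [r rS] := clear_denominators (rpred_nat _ (val p)) (@zloc_clear p) v.
exists (n.+1 * r)%N; rewrite exprM -map_mx_exp ME map_mxZ exprZn -scalemxAl.
rewrite scalemxAr; apply: mxOverM; first by apply/mxOverX/map_int_over.
by rewrite -[X in X ^+ _]/((val p)%:Z%:~R).
Qed.

(** Applied to the vectors [p^-1 e_j], the hypothesis makes all columns of one power of A divisible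
    by p. *)
Lemma nilpotent_of_lat : (forall v, lat (@zloc p) (ratM A) v) ->
  char_poly_mod p A = 'X^(n.+1).
Proof.
move=> latT; have kex j : exists k,
    ratM A ^+ k *m ((val p)%:R^-1 *: (delta_mx j 0 : 'cV_n.+1)) \is a mxOver (@zloc p).
  by have [k] := latT ((val p)%:R^-1 *: (delta_mx j 0 : 'cV_n.+1)); exists k.
have [k kP] := choice kex.
have Ak : (map_mx intr A : 'M['F_(val p)]_n.+1) ^+ (\max_j k j) = 0.
  apply/matrixP => i j; rewrite -map_mx_exp !mxE; apply/eqP; rewrite Fp_intr_eq0.
  apply: zloc_div_p; have := mxOverP (lat_le AS (leq_bigmax j) (kP j)) i 0.
  by rewrite -map_mx_exp -scalemxAr -colE !mxE mulrC.
by rewrite /char_poly_mod map_char_poly (nilpotent_char_poly Ak).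
Qed.

End LocalStructure.

Lemma Ggroup_zloc n (A : 'M[int]_n.+1) p v : \det A != 0 ->
  Ggroup A v -> lat (@zloc p) (ratM A) v.
Proof.
move=> dA /(Ggroup_lat dA)[k kZ]; exists k; apply: mxOverS kZ => q /intrP[m ->].
exact: rpred_int.
Qed.

Lemma mxOver_det (F : fieldType) (S : subringClosed F) n (M : 'M[F]_n) :
  M \is a mxOver S -> \det M \in S.
Proof.
move=> /mxOverP MS; apply: rpred_sum => s _; apply: rpredM.
  by rewrite rpredX // rpredN1.
by apply: rpred_prod => i _; apply: MS.
Qed.

(** * What an inclusion of T(G_A) in G_B says about determinants and entries *)

Section Images.
Variables (n : nat) (A B : 'M[int]_n.+1) (T : 'M[rat]_n.+1).
Hypotheses (dA : \det A != 0) (dB : \det B != 0) (Tu : T \in unitmx).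
Hypothesis TAB : forall v, Ggroup A v -> Ggroup B (T *m v).

Lemma Ggroup_over_zloc (p : prime_number) v : ~ Pset B p -> Ggroup A v ->
  T *m v \is a mxOver (@zloc p).
Proof.
by move=> pB /TAB/(Ggroup_zloc p dB); apply: lat_prime_to_det.
Qed.

(** If p did not divide [\det B], all matrices [T A^-k] would be over Z_(p). Taking determinants,
    [\det T] would be divisible by every power of p, hence zero. *)
Lemma Pset_image p : Pset A p -> Pset B p.
Proof.
move=> pA; apply: contrapT => pB.
suff d0 : \det T = 0 by move: Tu; rewrite unitmxE unitfE d0 eqxx.
have [m mE] := dvdzP pA.
apply: (@zloc_divisible_eq0 p) => k.
have TS : T *m (ratM A)^-1 ^+ k \is a mxOver (@zloc p).
  apply/mxOverP => i j; have := mxOverP (Ggroup_over_zloc pB (Ggroup_column A k j)) i 0.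
  by rewrite mulmxA -colE mxE.
have dE : \det (ratM A) = (\det A)%:~R by rewrite det_map_mx.
have dAk : \det ((ratM A)^-1 ^+ k) = (\det A)%:~R ^- k.
  elim: k {TS} => [|k IH]; first by rewrite expr0 det1 invr1.
  rewrite exprS -[_ * _]/(_ *m _) det_mulmx IH exprS invfM -dE; congr (_ * _).
  exact: det_inv.
have dA0 : ((\det A)%:~R : rat) != 0 by rewrite intr_eq0.
(* As [\det A = m p], the factor [m^k] turns [\det T / (\det A)^k] into [\det T / p^k]. *)
have := rpredM (rpred_int _ (m ^+ k)) (mxOver_det TS).
rewrite det_mulmx dAk mE intrM rmorphXn /= exprMn invfM mulrCA mulVKf ?mulrA //.
apply: expf_neq0; apply: contraNneq dA0 => m0; by rewrite mE intrM m0 mul0r.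
Qed.

Lemma Rring_int_den q : Rring A q <-> exists k, (\det A)%:~R ^+ k * q \is a Num.int.
Proof.
have d0 : ((\det A)%:~R : rat) != 0 by rewrite intr_eq0.
split.
  move=> [f _ <-]; exists (size f).
  rewrite horner_coef mulr_sumr; apply: rpred_sum => i _.
  have iL : (i < size f)%N by apply: leq_trans (ltn_ord i) (size_poly _ _).
  rewrite coef_map /= mulrCA rpredM ?rpred_int // -(subnK (ltnW iL)) exprD -mulrA -exprMn.
  by rewrite mulfV // expr1n mulr1 rpredX ?rpred_int.
move=> [k /intrP[m mE]]; exists (m *: 'X^k) => //.
rewrite map_polyZ map_polyXn hornerZ hornerXn /= -mE exprVn mulrAC mulfV ?mul1r //.
exact: expf_neq0.
Qed.

(** The j-th column of T is the image of [e_j], so some [B^k] makes it integral; multiplying by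
    [\adj B ^+ k] replaces [B^k] by the scalar [(\det B)^k]. *)
Lemma image_entries i j : exists k, (\det B)%:~R ^+ k * T i j \is a Num.int.
Proof.
have /TAB/(Ggroup_lat dB)[k kZ] := Ggroup_column A 0 j.
rewrite expr0 mul1mx -colE in kZ.
exists k; have -> : (\det B)%:~R = \det (ratM B) :> rat by rewrite det_map_mx.
have e : \adj (ratM B) ^+ k *m (ratM B ^+ k *m col j T) = (\det (ratM B) ^+ k) *: col j T.
  have c : GRing.comm (\adj (ratM B)) (ratM B).
    by rewrite /GRing.comm -[LHS]/(_ *m _) -[RHS]/(_ *m _) mul_mx_adj mul_adj_mx.
  rewrite mulmxA -[_ *m _ ^+ k]/(_ * _) -exprMn_comm // -[_ * _]/(_ *m _) mul_adj_mx.
  by rewrite -rmorphXn mul_scalar_mx.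
have BZ : ratM B \is a mxOver Num.int by apply: map_int_over.
have : \det (ratM B) ^+ k *: col j T \is a mxOver Num.int.
  by rewrite -e; apply: mxOverM => //; apply: mxOverX; apply: mxOver_adj.
by move/mxOverP/(_ i 0); rewrite !mxE.
Qed.

End Images.

Lemma Rring_sub n (A B : 'M[int]_n.+1) : \det A != 0 -> \det B != 0 ->
  (forall p, Pset A p -> Pset B p) -> forall q, Rring A q -> Rring B q.
Proof.
move=> dA dB AB q /(Rring_int_den dA)[k kZ]; apply/(Rring_int_den dB).
set a := `|\det A|%N; set b := `|\det B|%N.
have a0 : (0 < a)%N by rewrite absz_gt0.
(* The exponent [a = |\det A|] exceeds the multiplicity of every prime in a. *)
have : (\det A %| \det B ^+ a)%Z.
  rewrite dvdzE abszX -/a -/b; apply/dvdn_partP => // p.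
  rewrite mem_primes => /and3P[pp _ pa]; rewrite p_part.
  have pb : (p %| b)%N by have := AB (exist _ p pp); rewrite /Pset /= !dvdzE; apply.
  apply: (@dvdn_trans (p ^ a)); first by rewrite dvdn_exp2l // ltnW // ltn_logl.
  exact: dvdn_exp2r.
move=> /dvdzP[c cE]; exists (a * k)%N.
have -> : (\det B)%:~R ^+ (a * k) = c%:~R ^+ k * (\det A)%:~R ^+ k :> rat.
  by rewrite exprM -(rmorphXn intr) cE rmorphM exprMn.
by rewrite -mulrA rpredM // rpredX // rpred_int.
Qed.

Lemma tmult_size n (A : 'M[int]_n.+1) p : (tmult p A <= n.+1)%N.
Proof.
have hE : char_poly_mod p A = char_poly (map_mx intr A).
  by rewrite /char_poly_mod map_char_poly.
have h0 : char_poly_mod p A != 0 by rewrite hE monic_neq0 // char_poly_monic.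
have := leqnn (tmult p A); rewrite {2}/tmult mup_geq // => /(dvdp_leq h0).
by rewrite size_exp_XsubC hE size_char_poly.
Qed.

Section DivisibleDimension.
Variables (n : nat) (A B : 'M[int]_n.+1) (T : 'M[rat]_n.+1) (p : prime_number).
Variables (alphaA alphaB : forall p : prime_number, 'M[padic_int p]_n.+1).
Hypotheses (dA : \det A != 0) (dB : \det B != 0) (Tu : T \in unitmx).
Hypotheses (cA : is_characteristic A alphaA) (cB : is_characteristic B alphaB).
Hypotheses (pA : Pset' A p) (pB : Pset' B p).
Hypothesis TAB : forall v, Ggroup A v -> Ggroup B (T *m v).
Local Notation tA := (tmult p A).
Local Notation tB := (tmult p B).
Local Notation Tp := (map_mx (@qp p) T).
Local Notation x i := (char_vec tA (alphaA p) i).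

(* If [tB < tA], a nontrivial combination of the divisible generators of A is
   mapped by T to a divisible vector whose first [tB] coordinates vanish. *)
Lemma tmult_image : (tA <= tB)%N.
Proof.
rewrite leqNgt; apply/negP => ltBA.
have ltBn : (tB < n.+1)%N := leq_trans ltBA (tmult_size A p).
(* Row [i < tA] holds the first [tB] coordinates of [T x_i], the other rows are those of the
   identity. The column of index [tB < tA] is zero, and the identity rows force a left kernel vector
   c to be supported on [i < tA]. *)
pose M : 'M[padic p]_n.+1 := \matrix_(i, j)
  if (i < tA)%N then (if (j < tB)%N then (Tp *m x i) j 0 else 0) else (i == j)%:R.
have /eqP/det0P[c c0 cM] : \det M = 0.
  rewrite (expand_det_col M (Ordinal ltBn)) big1 // => i _; rewrite mxE /= ltnn.
  case: ltnP => [_|Ai]; first by rewrite mul0r.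
  by rewrite -val_eqE /= gtn_eqF ?mul0r // (leq_trans ltBA).
have cj j : \sum_i c 0 i * M i j = 0 by move/rowP/(_ j): cM; rewrite !mxE.
have c_ge (j : 'I_n.+1) : (tA <= j)%N -> c 0 j = 0.
  move=> Aj; rewrite -(cj j) (bigD1 j) //= big1 ?addr0 => [|i ij]; rewrite mxE.
    by rewrite ltnNge Aj eqxx mulr1.
  case: ltnP => iA; rewrite ?(negPf ij) ?mulr0 //.
  by rewrite ltnNge (leq_trans (ltnW ltBA) Aj) mulr0.
pose u := \sum_(i < n.+1 | (i < tA)%N) c 0 i *: x i.
have u_ell (k : 'I_n.+1) : (tA <= k)%N -> ell tA (alphaA p) u k = 0.
  move=> Ak; rewrite ell_sum big1 // => i iA; by rewrite ellZ ell_char_vec ?mulr0.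
have uD : dvs (@padicZ p) (map_mx intr A) u by apply/(dvs_ellP dA (cA pA)).
have TuD : dvs (@padicZ p) (map_mx intr B) (Tp *m u).
  by move=> a; rewrite scalemxAr; apply: lat_image dA dB TAB _ (uD a).
have TuE (j : 'I_n.+1) : (j < tB)%N -> (Tp *m u) j 0 = 0.
  move=> jB; rewrite mulmx_sumr summxE -[RHS](cj j).
  rewrite [RHS](bigID (fun i : 'I_n.+1 => (i < tA)%N)) /=.
  rewrite [X in _ = _ + X]big1 ?addr0 => [|i Ai]; last by rewrite c_ge ?mul0r // leqNgt.
  by apply: eq_bigr => i iA; rewrite -scalemxAr mxE [M i j]mxE iA jB.
(* Its first [tB] coordinates vanish by the choice of c, the coordinates [ell] by divisibility. *)
have Tu0 : Tp *m u = 0.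
  etransitivity; first exact: (char_decomposition tB (alphaB p)).
  rewrite big1 => [|i iB]; last by rewrite TuE ?scale0r.
  rewrite add0r big1 => [//|k Bk].
  by rewrite (iffLR (dvs_ellP dB (cB pB) _) TuD) ?scale0r.
have Tpu : Tp \in unitmx by rewrite map_unitmx.
have u0 : u = 0 by rewrite -[u](mulKmx Tpu) Tu0 mulmx0.
case/eqP: c0; apply/rowP => j; rewrite mxE.
have [/c_ge//|jA] := leqP tA j.
have := congr1 (fun v : 'cV_n.+1 => v j 0) u0.
rewrite summxE !mxE (bigD1 j) //= big1 ?addr0.
  by rewrite mxE char_vecE eqxx leqNgt jA addr0 mulr1.
by move=> i /andP[iA ij]; rewrite mxE char_vecE eq_sym (negPf ij) leqNgt jA addr0 mulr0.
Qed.

End DivisibleDimension.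

Lemma ell_column n t (p : prime_number) (alpha : 'M[padic_int p]_n.+1)
    (T : 'M[rat]_n.+1) k j :
  ell t alpha (map_mx (@qp p) (T *m delta_mx j 0)) k =
  ratr (T k j) - \sum_(i < n.+1 | (i < t)%N) ratr (T i j) * tofrac (alpha i k).
Proof.
rewrite -colE /ell; congr (_ - _); first by rewrite !mxE.
by apply: eq_bigr => i _; rewrite !mxE.
Qed.

Section LocMap.
Variables (K : fieldExtType rat) (p : prime_number).
Variable I : prime_idealr (ring_of_integers K).
Hypothesis Ip : lies_above I (val p).
Variables (n : nat) (A : 'M[int]_n.+1).
Local Notation AK := (map_mx intr A : 'M[K]_n.+1).

Lemma zloc_locE q : (GRing.in_alg K q \in loc I) = (q \in @zloc p).
Proof.
apply/idP/idP => [/(loc_rat (valP p) Ip)/zloc_denq //|/zlocP[s ps /intrP[m sm]]].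
apply/asboolP; exists m%:~R, s%:R; split; first by rewrite (nat_in_ideal Ip).
rewrite int_val_int int_val_nat.
rewrite -(rmorph_nat (GRing.in_alg K)) -(rmorph_int (GRing.in_alg K)).
by rewrite -sm mulrC rmorphM.
Qed.

(** Moves a question about rational vectors to K, where the spaces X live, and back. *)
Lemma lat_locE v :
  lat (loc I) AK (map_mx (GRing.in_alg K) v) <-> lat (@zloc p) (ratM A) v.
Proof.
have e k : AK ^+ k *m map_mx (GRing.in_alg K) v =
    map_mx (GRing.in_alg K) (ratM A ^+ k *m v).
  by rewrite map_mxM map_mx_exp map_mx_intr.
split=> -[k kS]; exists k; apply/mxOverP => i j.
  by rewrite -zloc_locE; have := mxOverP kS i j; rewrite e mxE.
by rewrite e mxE zloc_locE; apply: (mxOverP kS).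
Qed.

End LocMap.

(** * Sufficiency at one prime of [Pset'] *)

Section Core.
Variables (n : nat) (A B : 'M[int]_n.+1) (T : 'M[rat]_n.+1) (p : prime_number).
Variables (alphaA alphaB : forall p : prime_number, 'M[padic_int p]_n.+1).
Hypotheses (dA : \det A != 0) (dB : \det B != 0).
Hypotheses (cA : is_characteristic A alphaA) (cB : is_characteristic B alphaB).
Hypotheses (pA : Pset' A p) (pB : Pset' B p).
Hypothesis tAB : tmult p A = tmult p B.
Hypothesis condT : padic_condition B alphaB p T.
Variables (K : fieldExtType rat) (I : prime_idealr (ring_of_integers K)).
Hypothesis Ip : lies_above I (val p).
Local Notation TK := (map_mx (GRing.in_alg K) T).
Variables sA sB : seq (ring_of_integers K).
Hypothesis sAE :
  char_poly (map_mx intr A : 'M[K]_n.+1) = roots_poly (map (@int_val K) sA).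
Hypothesis sBE :
  char_poly (map_mx intr B : 'M[K]_n.+1) = roots_poly (map (@int_val K) sB).
Hypothesis TX : forall v, Xspace A I v -> Xspace B I (TK *m v).

Lemma lat_image_delta (j : 'I_n.+1) : (tmult p B <= j)%N ->
  lat (@zloc p) (ratM B) (T *m delta_mx j 0).
Proof.
move=> tj; apply: lat_zloc; apply/(lat_ellP dB (cB pB)) => k tk.
have := condT tk tj => /asboolP; by rewrite ell_column.
Qed.

Lemma Ggroup_image_zloc v : Ggroup A v -> lat (@zloc p) (ratM B) (T *m v).
Proof.
move=> vA; apply/(lat_locE Ip).
have BS : map_mx intr B \is a mxOver (loc I) by apply: map_int_over.
have [r1 r1P] := loc_bounded_mod_dvs (valP p) Ip sAE.
have [r2 r2P] := clear_denominators (loc_p (val p) I) (loc_clear (valP p) Ip) TK.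
have vL := Ggroup_lat_map dA _ (@qp p) vA.
(* [p^r1] splits w into x in X_{A,I} and an integral y; [p^r2] then makes [T y] integral, while
   every multiple of [T x] is in the lattice of B. *)
have [a [w [wL ->]]] := lat_approx dA (cA pA) (r1 + r2)%N (vL _).
have /r1P[x [y [xD yS xyE]]] := iffRL (lat_locE Ip A w) wL.
rewrite mulmxDr map_mxD mulmx_sumr map_mx_sum; apply: (latD BS).
  apply: lat_sum => // j tj; rewrite -scalemxAr map_mxZ; apply: latZ.
    by rewrite (rmorph_int (GRing.in_alg K)) rpred_int.
  by apply/(lat_locE Ip)/lat_image_delta; rewrite -tAB.
rewrite -scalemxAr map_mxZ map_mxM rmorphXn (rmorph_nat (GRing.in_alg K)).
rewrite addnC exprD -scalerA scalemxAr xyE mulmxDr scalerDr; apply: (latD BS).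
  have /(Xspace_dvs (valP p) Ip sBE) : Xspace B I (TK *m x).
    by apply: TX; apply/(Xspace_dvs (valP p) Ip sAE).
  by apply.
by rewrite scalemxAl; apply: lat_over; apply: mxOverM.
Qed.

End Core.

Lemma Rring_zloc n (B : 'M[int]_n.+1) p q : \det B != 0 -> ~ Pset B p ->
  Rring B q -> q \in @zloc p.
Proof.
move=> dB /negP pB /(Rring_int_den dB)[k /intrP[m mE]].
have d0 : ((\det B)%:~R : rat) != 0 by rewrite intr_eq0.
rewrite -(mulKf (expf_neq0 k d0) q) mE -exprVn.
by rewrite rpredM ?rpred_int // rpredX // zloc_inv_int.
Qed.

Section Sufficiency.
Variables (n : nat) (A B : 'M[int]_n.+1) (T : 'M[rat]_n.+1).
Variables (alphaA alphaB : forall p : prime_number, 'M[padic_int p]_n.+1).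
Hypotheses (dA : \det A != 0) (dB : \det B != 0).
Hypotheses (cA : is_characteristic A alphaA) (cB : is_characteristic B alphaB).
Variable K : fieldExtType rat.
Variables sA sB : seq (ring_of_integers K).
Hypothesis sAE :
  char_poly (map_mx intr A : 'M[K]_n.+1) = roots_poly (map (@int_val K) sA).
Hypothesis sBE :
  char_poly (map_mx intr B : 'M[K]_n.+1) = roots_poly (map (@int_val K) sB).
Hypotheses (PAB : Pset A = Pset B) (PAB' : Pset' A = Pset' B).
Hypothesis tAB : forall p, Pset A p -> tmult p A = tmult p B.
Hypothesis TR : forall i j, Rring B (T i j).
Hypothesis TX : forall p, Pset' A p -> forall I : prime_idealr (ring_of_integers K),
  lies_above I (val p) ->
  forall v, Xspace A I v -> Xspace B I (map_mx (GRing.in_alg K) T *m v).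
Hypothesis condT : forall p, Pset' A p -> padic_condition B alphaB p T.

(** Checked prime by prime: away from [\det B] both v and T are integral at p; if B is nilpotent
    modulo p, every vector is in the local lattice; at the remaining primes, one ideal I above p is
    enough. *)
Lemma Ggroup_image v : Ggroup A v -> Ggroup B (T *m v).
Proof.
move=> vA; apply: local_global => // p.
have [pB|pB] := pselect (Pset B p); last first.
  apply: lat_over; apply: mxOverM.
    by apply/mxOverP => i j; apply: Rring_zloc (TR i j).
  by apply: lat_prime_to_det (Ggroup_zloc p dA vA); rewrite PAB.
have [hB|hB] := pselect (char_poly_mod p B = 'X^(n.+1)); first exact: lat_nilpotent.
have pB' : Pset' B p by split.
have pA' : Pset' A p by rewrite PAB'.
have pA : Pset A p by rewrite PAB.
have [I Ip] := lying_over K (valP p).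
exact: (Ggroup_image_zloc dA dB cA cB pA' pB' (tAB pA) (condT pA') Ip sAE sBE
  (TX pA' Ip) vA).
Qed.

End Sufficiency.

(** * Necessity of the conditions *)

Section Necessity.
Variables (n : nat) (A B : 'M[int]_n.+1) (T : 'M[rat]_n.+1).
Hypotheses (dA : \det A != 0) (dB : \det B != 0) (Tu : T \in unitmx).
Hypothesis TAB : forall v, Ggroup A v -> Ggroup B (T *m v).
Hypothesis TBA : forall v, Ggroup B v -> Ggroup A (invmx T *m v).

(** Nilpotency modulo p means that the local lattice is the whole space, a property that the inverse
    of T carries from B to A. *)
Lemma Pset'_image p : Pset' A p -> Pset' B p.
Proof.
move=> [pA hA]; split; first exact: Pset_image Tu TAB _ pA.
move=> hB; apply: hA; apply: nilpotent_of_lat => v.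
rewrite -[v](mulKmx Tu); have <- : map_mx idfun (invmx T) = invmx T by apply: map_mx_id.
exact: (lat_image idfun dB dA TBA (lat_nilpotent _ hB)).
Qed.

Lemma Xspace_image (K : fieldExtType rat) (sA sB : seq (ring_of_integers K)) p
    (I : prime_idealr (ring_of_integers K)) :
  char_poly (map_mx intr A : 'M[K]_n.+1) = roots_poly (map (@int_val K) sA) ->
  char_poly (map_mx intr B : 'M[K]_n.+1) = roots_poly (map (@int_val K) sB) ->
  prime p -> lies_above I p ->
  forall v, Xspace A I v -> Xspace B I (map_mx (GRing.in_alg K) T *m v).
Proof.
move=> sAE sBE pp Ip v /(Xspace_dvs pp Ip sAE) vD; apply/(Xspace_dvs pp Ip sBE) => c.
by rewrite scalemxAr; apply: (lat_image (GRing.in_alg K) dA dB TAB).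
Qed.

Lemma padic_condition_image (alphaB : forall p : prime_number, 'M[padic_int p]_n.+1) p :
  is_characteristic B alphaB -> Pset' B p -> padic_condition B alphaB p T.
Proof.
move=> cB pB t k j tk tj; have TG : Ggroup B (T *m delta_mx j 0).
  by apply: TAB; have := Ggroup_column A 0 j; rewrite expr0 mul1mx.
have TL := iffLR (lat_ellP dB (cB p pB) _) (Ggroup_lat_map dB _ (@qp p) TG) k tk.
by rewrite ell_column in TL; apply/asboolP.
Qed.

End Necessity.

Theorem theorem4p3 (n : nat) (A B : 'M[int]_n.+1)
  (K : fieldExtType rat) (iota : {rmorphism K -> algC})
  (alphaA alphaB : forall p : prime_number, 'M[padic_int p]_n.+1)
  (T : 'M[rat]_n.+1) :
  \det A != 0 -> \det B != 0 ->
  (forall a : algC, eigenvalue (map_mx intr A) a \/ eigenvalue (map_mx intr B) a ->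
     exists x : K, iota x = a) ->
  is_characteristic A alphaA -> is_characteristic B alphaB ->
  T \in unitmx ->
  mx_image T (Ggroup A) = Ggroup B <->
  Pset A = Pset B /\
  Pset' A = Pset' B /\
  Rring A = Rring B /\
  (forall p, Pset A p -> tmult p A = tmult p B) /\
  inGL (Rring A) T /\
  (forall p, Pset' A p ->
     forall I : prime_idealr (ring_of_integers K), lies_above I (val p) ->
       mx_image (map_mx (GRing.in_alg K) T) (Xspace A I) = Xspace B I) /\
  (forall p, Pset' A p ->
     padic_condition B alphaB p T /\
     padic_condition A alphaA p (invmx T)).
Proof.
move=> dA dB eigK cA cB Tu.
have [sA sAE] := char_poly_split (fun a ha => eigK a (or_introl ha)).
have [sB sBE] := char_poly_split (fun a hb => eigK a (or_intror hb)).
have TKu : map_mx (GRing.in_alg K) T \in unitmx by rewrite map_unitmx.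
have Tiu : invmx T \in unitmx by rewrite unitmx_inv.
split.
  move=> TG.
  have TAB v : Ggroup A v -> Ggroup B (T *m v) by move=> vA; rewrite -TG; exists v.
  have TBA v : Ggroup B v -> Ggroup A (invmx T *m v).
    by rewrite -TG => -[w wA <-]; rewrite mulKmx.
  have TAB' v : Ggroup A v -> Ggroup B (invmx (invmx T) *m v).
    by rewrite invmxK; apply: TAB.
  have PAB p : Pset A p <-> Pset B p.
    by split; [apply: Pset_image TAB _ | apply: Pset_image TBA _].
  have PAB' p : Pset' A p <-> Pset' B p.
    by split; [apply: Pset'_image TAB TBA _ | apply: Pset'_image TBA TAB' _].
  have RAB q : Rring A q <-> Rring B q.
    by split; apply: Rring_sub => // p /PAB.
  split; first by apply/funext => p; apply/propext.
  split; first by apply/funext => p; apply/propext.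
  split; first by apply/funext => q; apply/propext.
  split.
    move=> p pA; have [pA'|npA'] := pselect (Pset' A p).
      have pB' := iffLR (PAB' p) pA'.
      have leAB := tmult_image dA dB Tu cA cB pA' pB' TAB.
      have leBA := tmult_image dB dA Tiu cB cA pB' pA' TBA.
      by apply/eqP; rewrite eqn_leq leAB leBA.
    (* At a prime of [Pset A] outside [Pset' A], both characteristic polynomials reduce to
       ['X^(n.+1)]. *)
    have hA : char_poly_mod p A = 'X^(n.+1) by apply: contrapT => hA; apply: npA'.
    have hB : char_poly_mod p B = 'X^(n.+1).
      by apply: contrapT => hB; apply/npA'/PAB'; split=> //; apply/PAB.
    by rewrite /tmult hA hB.
  split.
    exists (invmx T); split=> [i j|i j||]; last 2 first; rewrite ?mulmxV ?mulVmx //.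
      by apply/RAB/(Rring_int_den dB); apply: image_entries TAB _ _.
    by apply/(Rring_int_den dA); apply: image_entries TBA _ _.
  split=> [p pA I Ip|p pA].
    apply/seteqP; split=> [_ [v vX <-]|v vX].
      exact: (Xspace_image dA dB TAB sAE sBE (valP p) Ip vX).
    exists (invmx (map_mx (GRing.in_alg K) T) *m v); last by rewrite mulKVmx.
    by rewrite -map_invmx; apply: (Xspace_image dB dA TBA sBE sAE (valP p) Ip vX).
  split; first exact: (padic_condition_image dB TAB cB (iffLR (PAB' p) pA)).
  exact: (padic_condition_image dA TBA cA pA).
move=> [PAB [PAB' [RAB [tAB [[S [TR SR TS ST]] [TX cond]]]]]].
have SE : S = invmx T by rewrite -[S]mul1mx -(mulVmx Tu) -mulmxA TS mulmx1.
have TAB v : Ggroup A v -> Ggroup B (T *m v).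
  apply: (Ggroup_image dA dB cA cB sAE sBE PAB PAB' tAB).
  - by move=> i j; rewrite -RAB.
  - by move=> p pA I Ip w wX; rewrite -(TX p pA I Ip); exists w.
  - by move=> p /cond[].
have TBA v : Ggroup B v -> Ggroup A (invmx T *m v).
  apply: (Ggroup_image dB dA cB cA sBE sAE (esym PAB) (esym PAB')).
  - by move=> p pB; rewrite tAB // PAB.
  - by move=> i j; rewrite -SE.
  - move=> p; rewrite -PAB' => pA I Ip w; rewrite -(TX p pA I Ip) => -[u uX <-].
    by rewrite map_invmx mulKmx.
  - by move=> p; rewrite -PAB' => /cond[].
apply/seteqP; split=> [_ [v vA <-]|v vB]; first exact: TAB.
by exists (invmx T *m v); [apply: TBA | rewrite mulKVmx].
Qed.
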